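(* There exists a nontrivial algebraic subset $\Sigma\subset\mathscr{F}(2;2)$ (that is, $\Sigma$ is Zariski closed in $\mathscr{F}(2;2)$, $\Sigma\neq\emptyset$ and $\Sigma\neq\mathscr{F}(2;2)$) with the following property: for every foliation $\mathcal{F}\in\mathscr{F}(2;2)\setminus\Sigma$, the closure of the orbit $\mathcal{O}(\mathcal{F})$ contains $\mathcal{F}_1$, where $\mathcal{F}_1$ is the foliation described in the affine chart $Z=1$ by $\omega_1=x^2\,\mathrm{d}x+y^2(x\,\mathrm{d}y-y\,\mathrm{d}x)$. In particular, for every $\mathcal{F}\in\mathscr{F}(2;2)\setminus\Sigma$, the orbit $\mathcal{O}(\mathcal{F})$ is not closed in $\mathscr{F}(2;2)$.
   Context: $\mathscr{F}(2;2)$ is the set of quadratic (degree $2$) foliations on $\mathbb{P}^2(\mathbb{C})$: a foliation of degree $N$ is given, up to a nonzero scalar, by a homogeneous $1$-form $\omega=a\,\mathrm{d}X+b\,\mathrm{d}Y+c\,\mathrm{d}Z$ with $a,b,c$ homogeneous of degree $N+1$ without common factor and $aX+bY+cZ=0$. Thus $\mathscr{F}(2;2)$ is a Zariski open subset of $\mathbb{P}^{14}(\mathbb{C})$, the projectivization of the space of $1$-forms with homogeneous coefficients of degree $3$ satisfying $aX+bY+cZ=0$. In the chart $Z=1$, $x=X/Z$, $y=Y/Z$, the foliation is described by the restriction of $\omega$. $\mathrm{Aut}(\mathbb{P}^2(\mathbb{C}))=\mathrm{PGL}_3(\mathbb{C})$ acts on $\mathscr{F}(2;2)$ by pullback, and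 $\mathcal{O}(\mathcal{F})$ is the orbit of $\mathcal{F}$. Closures are taken in $\mathscr{F}(2;2)$ for the ordinary topology. *)

(* Defs.v *)
From mathcomp Require Import all_boot all_order all_algebra.
From mathcomp Require Import generic_quotient complex.
From mathcomp Require Import boolp classical_sets reals topology normedtype.
(* The notations of mpoly are not compatible with those of the topology files;
   [mpoly n A], [mpolyC n c], [mcoeff m p], [meval v p], [comp_mpoly lq p] and
   [ishomog1 d mdeg] stand for {mpoly A[n]}, c%:MP, p@_m, p.@[v], p \mPo lq and
   d.-homog. *)
From mathcomp.multinomials Require Import -(notations) mpoly.

Set Implicit Arguments.
Unset Strict Implicit.
Unset Printing Implicit Defensive.

Import GRing.Theory Num.Theory numFieldNormedType.Exports.
Local Open Scope ring_scope.
Local Open Scope classical_set_scope.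
Local Open Scope quotient_scope.

Section QuadraticFoliations.
Variable R : realType.

(* The complex numbers as a field with a norm, hence with their ordinary
   topology. *)
Definition complex_field : numClosedFieldType := R[i].
Local Notation C := complex_field.

Definition Xvar n (i : 'I_n) : mpoly n C := mpolyX C (mnm1 i).

(* The 1-form a dX + b dY + c dZ is the row (a, b, c). *)
Definition one_form := 'rV[mpoly 3 C]_3.

Definition is_cubic_form (w : one_form) : bool :=
  [&& w != 0,
      [forall i, w 0 i \is ishomog1 3 mdeg] &
      \sum_i w 0 i * Xvar i == 0].

Definition cubic_form : Type := {w : one_form | is_cubic_form w}.

(* A cubic form has 30 coefficients; the Euler relation makes the space of
   forms a 15-dimensional linear subspace of C^30, and both the ordinary and
   the Zariski topology below are the ones induced from C^30. *)
Definition form_index : finType :=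
  ('I_3 * {m : bmultinom 3 4 | mdeg (val m) == 3%N})%type.

Definition coords (w : cubic_form) : 'rV[C]_#|form_index| :=
  \row_k mcoeff (val (val (enum_val k).2)) (val w 0 (enum_val k).1).

Definition form_space : topologicalType := initial_topology coords.

Definition proportional (w w' : form_space) : bool :=
  `[< exists2 c : C, c != 0 & forall i, val w' 0 i = c *: val w 0 i >].

Lemma proportional_equiv : equiv_class_of proportional.
Proof.
split=> [w | w w' | w2 w1 w3].
- by apply/asboolP; exists 1 => [|i]; rewrite ?oner_neq0 // scale1r.
- have sym u v : proportional u v -> proportional v u.
    move=> /asboolP[c c0 e]; apply/asboolP; exists c^-1; first by rewrite invr_eq0.
    by move=> i; rewrite e scalerK.
  by apply/idP/idP; exact: sym.
- move=> /asboolP[c c0 e] /asboolP[d d0 f]; apply/asboolP; exists (d * c).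
    by rewrite mulf_neq0.
  by move=> i; rewrite f e scalerA.
Qed.

Canonical proportional_equiv_rel := EquivRelPack proportional_equiv.

(* P^14(C), with the quotient topology. *)
Definition P14 : topologicalType :=
  quotient_topology {eq_quot proportional}.

Definition proj_class (w : form_space) : P14 :=
  \pi_(quotient_topology {eq_quot proportional}) w.

Definition no_common_factor (w : one_form) : Prop :=
  forall d : mpoly 3 C,
    (forall i, exists q, w 0 i = d * q) -> d \is a GRing.unit.

(* The set F(2;2) of quadratic foliations, as a subset of P^14. *)
Definition F22 : set P14 :=
  [set F | exists2 w : form_space, proj_class w = F & no_common_factor (val w)].

(* The topology of [subspace F22] is the one induced on F22, the other points of
   P14 being isolated; it describes F(2;2) for subsets of F22. *)
Definition closure_in_F22 (A : set P14) : set P14 :=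
  closure (A : set (subspace F22)).

Definition closed_in_F22 (A : set P14) : Prop :=
  closed (A : set (subspace F22)).

(* Pullback of a 1-form by the linear map with matrix A. *)
Definition pullback (A : 'M[C]_3) (w : one_form) : one_form :=
  map_mx (comp_mpoly [tuple \sum_j mpolyC 3 (A i j) * Xvar j | i < 3]) w
    *m map_mx (@mpolyC 3 C) A.

(* Scalar matrices act trivially on P^14, so that orbits under PGL_3 are
   orbits under GL_3. *)
Definition PGL3_orbit (F : P14) : set P14 :=
  [set G | exists A : 'M[C]_3, A \in unitmx /\
     exists w w' : form_space,
       [/\ proj_class w = F, proj_class w' = G & val w' = pullback A (val w)]].

Definition zariski_closed_in_F22 (S : set P14) : Prop :=
  exists I : set (mpoly #|form_index| C),
    (forall p, I p -> p \is ishomog mdeg) /\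
    S = F22 `&` [set F | forall p, I p ->
                   forall w : form_space, proj_class w = F ->
                     meval (fun k => coords w 0 k) p = 0].

(* Restriction of a 1-form to the chart Z = 1, as the pair of its coefficients
   along dx and dy. *)
Definition chart (w : one_form) : 'rV[mpoly 2 C]_2 :=
  \row_j comp_mpoly [tuple Xvar 0; Xvar 1; 1] (w 0 (widen_ord (leqnSn 2) j)).

Section Omega1.
Let X : mpoly 3 C := Xvar 0.
Let Y : mpoly 3 C := Xvar 1.
Let Z : mpoly 3 C := Xvar 2%:R.

Definition omega1 : one_form :=
  \row_j [:: X ^+ 2 * Z - Y ^+ 3; X * Y ^+ 2; - X ^+ 3]`_j.

(* omega1 restricts to x^2 dx + y^2 (x dy - y dx). *)
Lemma chart_omega1 (x := Xvar 0) (y := Xvar 1) :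
  chart omega1 = \row_j [:: x ^+ 2 - y ^+ 2 * y; y ^+ 2 * x]`_j.
Proof.
apply/rowP=> j; rewrite !mxE.
have Ex i : comp_mpoly [tuple Xvar 0; Xvar 1; 1] (Xvar i) =
            tnth [tuple Xvar 0; Xvar 1; 1] i :> mpoly 2 C.
  by rewrite /comp_mpoly mmapX mmap1U.
have := Ex 0; have := Ex 1; have := Ex 2%:R; rewrite !(tnth_nth 0) /= => EZ EY EX.
case: j => [[|[|//]] lt_j2] /=.
  rewrite raddfB /= rmorphM /= [comp_mpoly _ (X ^+ 2)]rmorphXn.
  rewrite [comp_mpoly _ (Y ^+ 3)]rmorphXn /= EX EY EZ.
  by rewrite mulr1 -exprSr.
by rewrite rmorphM /= [comp_mpoly _ (Y ^+ 2)]rmorphXn /= EX EY mulrC.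
Qed.

Lemma omega1_cubic : is_cubic_form omega1.
Proof.
have hX i : Xvar i \is ishomog1 1 (@mdeg 3) by rewrite dhomogX; apply/eqP; exact: mdeg1.
have hXn i k : Xvar i ^+ k \is ishomog1 k (@mdeg 3).
  by have := dhomogMn k (hX i); rewrite mul1n.
apply/and3P; split.
- apply/eqP=> /rowP/(_ 1); rewrite !mxE /= => /eqP.
  by rewrite mulf_eq0 expf_eq0 /= -!msupp_eq0 !msuppX.
- apply/forallP=> j; rewrite mxE; case: j => [[|[|[|//]]] lt_j3] /=.
  + apply: rpredB; last exact: hXn 1 3%N.
    exact: dhomogM (hXn 0 2%N) (hX 2%:R).
  + exact: dhomogM (hX 0) (hXn 1 2%N).
  + by rewrite rpredN; exact: hXn.
rewrite !big_ord_recl big_ord0 !mxE /= addr0.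
rewrite (_ : lift ord0 ord0 = 1); last exact/val_inj.
rewrite (_ : lift ord0 (lift ord0 ord0) = 2%:R); last exact/val_inj.
rewrite -/X -/Y -/Z mulrBl mulNr.
rewrite (_ : X * Y ^+ 2 * Y = Y ^+ 3 * X); last first.
  by rewrite -mulrA -exprSr mulrC.
rewrite (_ : X ^+ 3 * Z = X ^+ 2 * Z * X); last first.
  by rewrite exprSr mulrAC.
by rewrite addrA subrK subrr.
Qed.

End Omega1.

Definition F1 : P14 := proj_class (exist _ omega1 omega1_cubic).

End QuadraticFoliations.

Arguments F22 R : clear implicits.

(* Main.v *)
Require Import Defs.
From mathcomp Require Import all_boot boolp classical_sets reals topology.
From mathcomp Require Import all_order all_algebra.
From mathcomp Require Import generic_quotient complex normedtype.
From mathcomp.multinomials Require Import -(notations) mpoly.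
From mathcomp Require Import ring.

(** The property behind the theorem is the existence of a nonsingular point p
of F at which the tangent line L is not invariant and meets F to order exactly
two, the largest order possible in degree 2.  Put p at (1 : 0 : 0) and L at
Z = 0.  With omega = a dX + b dY + c dZ, this says that
b(X, Y, 0) = beta X Y^2 with beta <> 0, and that the coefficient of X^3 in c is
some gamma <> 0.  Pull back by diag(1, eps, kappa eps^3): the coefficient of a
monomial X^i Y^j Z^k in a, b or c is multiplied by a constant times
eps^(j + 3 k), eps^(j + 3 k + 1) or eps^(j + 3 k + 3).  The coefficients with
exponent below 3 all vanish, those with exponent 3 are exactly the ones that
occur in omega1, up to constants that a suitable kappa turns into the right
ones, and all the others have exponent above 3.  After division by
beta eps^3 the forms therefore tend to omega1 as eps tends to 0
([degeneration_coef], [degenerate_omega1]).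

Such a point p is sought on the lines through e = (1 : 0 : 0).  On the line
through e and (0 : t : 1) the tangencies with F are the zeros of a binary
quadratic form with coefficients [tang0], [tang1], [tang2], polynomials in t.
Its discriminant has degree at most 4 in t, and it has a root when the
coefficient of t^4 does not vanish; at the root the two tangencies come together
at a point p.  The line is not invariant if [tang0] and [tang1] have no common root, which is
the nonvanishing of [tang_res].  The point p is nonsingular if t is not a root
of [sing_obstr], and a Sylvester determinant guarantees this for every root of
the discriminant ([inflection_point]).

For the orbit not to be closed, F1 must not lie in it.  The coefficients of
omega1 vanish to order two at (0 : 0 : 1), so those of each form in its orbit
vanish to order two at some point.  Their first derivatives are then quadratic
forms with a common zero, and the determinant of the coefficients of any six of
them is zero ([gradient_mx_orbit]).

Sigma is the zero locus of the product of [tang_res], the coefficient of t^4 in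
the discriminant, the Sylvester determinant and one determinant of this last
kind, a homogeneous polynomial in the coefficients of the form.  It contains F1,
and the foliation of the vector field (z^2 + y z) d/dx + x^2 d/dy + x y d/dz, for which all the
matrices involved are triangular, lies outside it ([exceptional_example]). *)

Set Implicit Arguments.
Unset Strict Implicit.
Unset Printing Implicit Defensive.

Import Order.TTheory GRing.Theory Num.Theory numFieldNormedType.Exports.
Local Open Scope ring_scope.
Local Open Scope classical_set_scope.
Local Open Scope quotient_scope.

(** * Coefficients of ternary cubic forms *)

(** A cubic form is given by its coefficients: [T i j k] is that of
x^i y^j z^k, and only the values with i + j + k = 3 matter. *)
Definition cubic_eval (K : comPzRingType) (T : nat -> nat -> nat -> K)
  (x y z : K) : K :=
  T 3 0 0 * x ^+ 3 + T 2 1 0 * x ^+ 2 * y + T 2 0 1 * x ^+ 2 * z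
  + T 1 2 0 * x * y ^+ 2 + T 1 1 1 * x * y * z + T 1 0 2 * x * z ^+ 2
  + T 0 3 0 * y ^+ 3 + T 0 2 1 * y ^+ 2 * z + T 0 1 2 * y * z ^+ 2
  + T 0 0 3 * z ^+ 3.

Lemma cubic_eval_sum (K : comPzRingType) (T : nat -> nat -> nat -> K) (x y z : K) :
  T 3 0 0 * (x ^+ 3 * y ^+ 0 * z ^+ 0) + (T 2 1 0 * (x ^+ 2 * y ^+ 1 * z ^+ 0)
  + (T 2 0 1 * (x ^+ 2 * y ^+ 0 * z ^+ 1) + (T 1 2 0 * (x ^+ 1 * y ^+ 2 * z ^+ 0)
  + (T 1 1 1 * (x ^+ 1 * y ^+ 1 * z ^+ 1) + (T 1 0 2 * (x ^+ 1 * y ^+ 0 * z ^+ 2)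
  + (T 0 3 0 * (x ^+ 0 * y ^+ 3 * z ^+ 0) + (T 0 2 1 * (x ^+ 0 * y ^+ 2 * z ^+ 1)
  + (T 0 1 2 * (x ^+ 0 * y ^+ 1 * z ^+ 2) + (T 0 0 3 * (x ^+ 0 * y ^+ 0 * z ^+ 3)
  + 0))))))))) = cubic_eval T x y z.
Proof. by rewrite /cubic_eval; ring. Qed.

(** The relation aX + bY + cZ = 0, read off at the monomial X^i Y^j Z^k. *)
Definition euler_rel (K : pzRingType) (a b c : nat -> nat -> nat -> K) :=
  forall i j k, (i + j + k = 4)%N ->
    (if (0 < i)%N then a i.-1 j k else 0) + (if (0 < j)%N then b i j.-1 k else 0)
    + (if (0 < k)%N then c i j k.-1 else 0) = 0.

(** * A Sylvester determinant for two polynomials of degree at most 4 *)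

Lemma size_polyM_leq (K : nzRingType) (p q : {poly K}) m n :
  (size p <= m.+1)%N -> (size q <= n.+1)%N -> (size (p * q)%R <= (m + n).+1)%N.
Proof.
move=> sp sq; apply: leq_trans (size_polyMleq p q) _.
rewrite -subn1 leq_subLR add1n -addnS -addSn.
exact: leq_add.
Qed.

(** The Sylvester matrix, always of size 8, of two polynomials treated as being
of degree 4; its rows are X^i p, then X^i q, for i < 4. *)
Definition sylvester4 (K : nzRingType) (p q : {poly K}) : 'M[K]_8 :=
  \matrix_(i, j) (if (i < 4)%N then 'X^i * p else 'X^(i - 4) * q)`_j.

(** A common root t would put the column (1, t, ..., t^7) in the kernel. *)
Lemma sylvester4_root (K : fieldType) (p q : {poly K}) t :
  (size p <= 5)%N -> (size q <= 5)%N ->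
  \det (sylvester4 p q) != 0 -> root q t -> p.[t] != 0.
Proof.
move=> sp sq dS /rootP qt; apply: contraNneq dS => pt.
rewrite -det_tr; apply/det0P; exists (\row_(j < 8) t ^+ j).
  apply/eqP=> /rowP/(_ 0); rewrite !mxE => /eqP.
  by rewrite expr0 oner_eq0.
apply/rowP=> i; rewrite !mxE.
set r := if (i < 4)%N then 'X^i * p else 'X^(i - 4) * q.
have sr : (size r <= 8)%N.
  rewrite /r; case: ifPn => i4.
    apply: leq_trans (size_polyM_leq (m := i) _ sp) _.
      by rewrite size_polyXn.
    by rewrite addn4.
  apply: leq_trans (size_polyM_leq (m := i - 4) _ sq) _.
    by rewrite size_polyXn.
  by rewrite subnK ?ltn_ord // leqNgt.
transitivity r.[t].
  by rewrite (horner_coef_wide _ sr); apply: eq_bigr => j _; rewrite !mxE mulrC.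
by rewrite /r; case: ifP; rewrite hornerM ?pt ?qt mulr0.
Qed.

(** * Lines through a fixed point and their tangencies with a foliation *)

Section Pencil.
Variables (K : comNzRingType) (b c : nat -> nat -> nat -> K).

(** By the Euler relation, (a, b, c) = (y v_z - z v_y, z v_x - x v_z,
x v_y - y v_x) for a quadratic vector field v whose component v_x involves y
and z only; so v_y and v_z are the quotients by x of c and -b, up to terms
without x.  At (s, t, 1) one has v_y = c_300 s^2 + s vy1 + vy2,
v_z = - b_300 s^2 + s vz1 + vz2 and v_x = vx, and the line through (1, 0, 0)
and (0, t, 1) is tangent to the foliation at (s, t, 1) when
t v_z - v_y = tang0 s^2 + tang1 s + tang2 vanishes. *)
Definition tang0 : {poly K} := - (b 3 0 0)%:P * 'X - (c 3 0 0)%:P.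
Definition vz1 : {poly K} := - ((b 2 1 0)%:P * 'X + (b 2 0 1)%:P).
Definition vy1 : {poly K} := (c 2 1 0)%:P * 'X + (c 2 0 1)%:P.
Definition vz2 : {poly K} :=
  - ((b 1 2 0)%:P * 'X^2 + (b 1 1 1)%:P * 'X + (b 1 0 2)%:P).
Definition vy2 : {poly K} :=
  (c 1 2 0)%:P * 'X^2 + (c 1 1 1)%:P * 'X + (c 1 0 2)%:P.
Definition vx : {poly K} :=
  - ((c 0 3 0)%:P * 'X^2 + (c 0 2 1)%:P * 'X + (c 0 1 2)%:P).
Definition tang1 := 'X * vz1 - vy1.
Definition tang2 := 'X * vz2 - vy2.
(** The combination - b_300 v_y - c_300 v_z, which has no term in s^2, equals
s elim1 + elim2 at (s, t, 1). *)
Definition elim1 := - (b 3 0 0)%:P * vy1 - (c 3 0 0)%:P * vz1.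
Definition elim2 := - (b 3 0 0)%:P * vy2 - (c 3 0 0)%:P * vz2.

Definition tang_discr := tang1 * tang1 - 4%:P * (tang0 * tang2).
(** At a double root s of the tangency form, v_y = t v_z, so that (s, t, 1) is
singular exactly when v_x = s v_z.  This polynomial is
2 tang0^2 (v_x - s v_z) with s eliminated by 2 tang0 s = - tang1 and
tang0 s^2 = tang2. *)
Definition sing_obstr :=
  2%:P * (tang0 * tang0 * vx) - 2%:P * (tang2 * elim1) + tang1 * elim2.

(** The resultant of [tang0] and [tang1]: as a form in (t, 1), [tang0] vanishes at
(c_300, - b_300), and this is the value of [tang1] there. *)
Definition tang_res : K :=
  - b 2 1 0 * (c 3 0 0 * c 3 0 0)
  - (- b 2 0 1 - c 2 1 0) * (c 3 0 0 * b 3 0 0)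
  - c 2 0 1 * (b 3 0 0 * b 3 0 0).

Let hornerEs := (hornerD, hornerN, hornerM, hornerX, hornerC, hornerXn).

Lemma horner_tang0 t : tang0.[t] = - b 3 0 0 * t - c 3 0 0.
Proof. by rewrite /tang0 !hornerEs. Qed.

Lemma horner_tang1 t :
  tang1.[t] = - b 2 1 0 * t ^+ 2 - (b 2 0 1 + c 2 1 0) * t - c 2 0 1.
Proof. by rewrite /tang1 /vy1 /vz1 !hornerEs; ring. Qed.

Lemma horner_tang2 t : tang2.[t] =
  t * - (b 1 2 0 * t ^+ 2 + b 1 1 1 * t + b 1 0 2)
  - (c 1 2 0 * t ^+ 2 + c 1 1 1 * t + c 1 0 2).
Proof. by rewrite /tang2 /vy2 /vz2 !hornerEs. Qed.

Lemma horner_elim1 t : elim1.[t] =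
  - b 3 0 0 * (c 2 1 0 * t + c 2 0 1) + c 3 0 0 * (b 2 1 0 * t + b 2 0 1).
Proof. by rewrite /elim1 /vy1 /vz1 !hornerEs; ring. Qed.

Lemma horner_elim2 t : elim2.[t] =
  - b 3 0 0 * (c 1 2 0 * t ^+ 2 + c 1 1 1 * t + c 1 0 2)
  + c 3 0 0 * (b 1 2 0 * t ^+ 2 + b 1 1 1 * t + b 1 0 2).
Proof. by rewrite /elim2 /vy2 /vz2 !hornerEs; ring. Qed.

Lemma horner_vx t : vx.[t] = - (c 0 3 0 * t ^+ 2 + c 0 2 1 * t + c 0 1 2).
Proof. by rewrite /vx !hornerEs. Qed.

Lemma tang_resE t : tang0.[t] = 0 -> (b 3 0 0) ^+ 2 * tang1.[t] = tang_res.
Proof.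
rewrite horner_tang0 horner_tang1 /tang_res => e.
have {e}-> : c 3 0 0 = - b 3 0 0 * t by apply/esym/eqP; rewrite -subr_eq0 e.
by ring.
Qed.

Let sC (x : K) : (size x%:P <= 1)%N. Proof. exact: size_polyC_leq1. Qed.
Let sX : (size ('X : {poly K}) <= 2)%N. Proof. by rewrite size_polyX. Qed.
Let sXn n : (size ('X^n : {poly K}) <= n.+1)%N. Proof. by rewrite size_polyXn. Qed.
Let sD (p q : {poly K}) n : (size p <= n)%N -> (size q <= n)%N ->
  (size (p + q)%R <= n)%N.
Proof. by move=> sp sq; apply: leq_trans (size_polyD _ _) _; rewrite geq_max sp. Qed.
Let sN (p : {poly K}) n : (size p <= n)%N -> (size (- p)%R <= n)%N.
Proof. by rewrite size_polyN. Qed.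

Let s_tang0 : (size tang0 <= 2)%N.
Proof.
by apply: sD; [exact: (size_polyM_leq (m := 0) (n := 1) (sN (sC _)) sX)
  |exact: leq_trans (sN (sC _)) _].
Qed.

Let s_lin x y : (size (x%:P * 'X + y%:P : {poly K})%R <= 2)%N.
Proof.
by apply: sD; [exact: (size_polyM_leq (m := 0) (n := 1) (sC _) sX)
  |exact: leq_trans (sC _) _].
Qed.

Let s_quad x y z : (size (x%:P * 'X^2 + y%:P * 'X + z%:P : {poly K})%R <= 3)%N.
Proof.
apply: sD; last exact: leq_trans (sC _) _.
apply: sD; first exact: (size_polyM_leq (m := 0) (n := 2) (sC _) (sXn 2)).
by apply: leq_trans (size_polyM_leq (m := 0) (n := 1) (sC _) sX) _.
Qed.

Let s_tang1 : (size tang1 <= 3)%N.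
Proof.
apply: sD; first exact: (size_polyM_leq (m := 1) (n := 1) sX (sN (s_lin _ _))).
by apply/sN; apply: leq_trans (s_lin _ _) _.
Qed.

Let s_tang2 : (size tang2 <= 4)%N.
Proof.
apply: sD; first exact: (size_polyM_leq (m := 1) (n := 2) sX (sN (s_quad _ _ _))).
by apply/sN; apply: leq_trans (s_quad _ _ _) _.
Qed.

Lemma size_tang_discr : (size tang_discr <= 5)%N.
Proof.
apply: sD; first exact: (size_polyM_leq (m := 2) (n := 2) s_tang1 s_tang1).
apply: sN; apply: (size_polyM_leq (m := 0) (n := 4) (sC _)).
exact: (size_polyM_leq (m := 1) (n := 3) s_tang0 s_tang2).
Qed.

Lemma size_sing_obstr : (size sing_obstr <= 5)%N.
Proof.
have s_elim1 : (size elim1 <= 2)%N.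
  apply: sD; last apply/sN;
   by apply: (size_polyM_leq (m := 0) (n := 1)); rewrite ?sC ?sN ?s_lin.
have s_elim2 : (size elim2 <= 3)%N.
  apply: sD; last apply/sN;
   by apply: (size_polyM_leq (m := 0) (n := 2)); rewrite ?sC ?sN ?s_quad.
apply: sD; first apply: sD; last exact: (size_polyM_leq (m := 2) (n := 2)).
  apply: (size_polyM_leq (m := 0) (n := 4) (sC _)).
  apply: (size_polyM_leq (m := 2) (n := 2)); last exact/sN.
  exact: (size_polyM_leq (m := 1) (n := 1)).
apply: sN; apply: (size_polyM_leq (m := 0) (n := 4) (sC _)).
exact: (size_polyM_leq (m := 3) (n := 1)).
Qed.

End Pencil.

(** At a root t of the discriminant, [tang0] does not vanish, for otherwise [tang1]
would vanish as well.  The double tangency is then at s = - tang1 / (2 tang0),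
and beta = tang0(t).  The first conclusion is the restriction to the line
spanned by p = (s, t, 1) and e = (1, 0, 0), evaluated on e; the second is
the value of the form at p on the transversal vector (0, 1, 0). *)
Lemma inflection_point (K : numClosedFieldType) (a b c : nat -> nat -> nat -> K) :
  euler_rel a b c -> tang_res b c != 0 -> (tang_discr b c)`_4 != 0 ->
  \det (sylvester4 (sing_obstr b c) (tang_discr b c)) != 0 ->
  exists s t, exists2 beta, beta != 0 &
    (forall x y, cubic_eval a (s * x + y) (t * x) x = beta * x * y ^+ 2) /\
    cubic_eval b s t 1 != 0.
Proof.
move=> eul r0 d4 dS.
have /closed_rootP[t Dt] : size (tang_discr b c) != 1%N.
  by apply: contraNneq d4 => s1; rewrite nth_default ?s1.
have Nt := sylvester4_root (size_sing_obstr b c) (size_tang_discr b c) dS Dt.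
set G0 := (tang0 b c).[t]; set G1 := (tang1 b c).[t]; set G2 := (tang2 b c).[t].
have eD : G1 * G1 = 4 * (G0 * G2).
  by apply/eqP; rewrite -subr_eq0; move: Dt; rewrite /tang_discr /root
    hornerD hornerN !hornerM hornerC.
have G0n : G0 != 0.
  apply: contraNneq r0 => e; rewrite -(tang_resE e).
  move: eD; rewrite e mul0r mulr0 => /eqP; rewrite mulf_eq0 orbb => /eqP.
  by rewrite /G1 => ->; rewrite mulr0.
pose s := - G1 / (2 * G0).
have eG1 : G1 = - 2 * G0 * s by rewrite /s; field.
have eG2 : G2 = G0 * s ^+ 2.
  have n4 : 4 != 0 :> K by rewrite pnatr_eq0.
  apply: (mulfI (mulf_neq0 n4 G0n)).
  by rewrite -mulrA -eD eG1; ring.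
have E400 := eul 4 0 0 erefl; have E310 := eul 3 1 0 erefl.
have E301 := eul 3 0 1 erefl; have E220 := eul 2 2 0 erefl.
have E211 := eul 2 1 1 erefl; have E202 := eul 2 0 2 erefl.
have E130 := eul 1 3 0 erefl; have E121 := eul 1 2 1 erefl.
have E112 := eul 1 1 2 erefl; have E103 := eul 1 0 3 erefl.
have E040 := eul 0 4 0 erefl; have E031 := eul 0 3 1 erefl.
have E022 := eul 0 2 2 erefl; have E013 := eul 0 1 3 erefl.
move: E400 E310 E301 E220 E211 E202 E130 E121 E112 E103 E040 E031 E022 E013.
rewrite /= !add0r !addr0.
have opp2 (x y : K) : x + y = 0 -> x = - y by move/eqP; rewrite addr_eq0 => /eqP.
move=> a300 /opp2 a210 /opp2 a201 /opp2 a120 e211 /opp2 a102 /opp2 a030 e121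
  e112 /opp2 a003 b030 /opp2 b021 /opp2 b012 /opp2 b003.
move: e211 e121 e112; rewrite -!addrA => /opp2 a111 /opp2 a021 /opp2 a012.
exists s, t, G0 => //; split=> [x y|].
  transitivity (x * (G0 * (s * x + y) ^+ 2 + G1 * ((s * x + y) * x) + G2 * x ^+ 2)).
    rewrite /cubic_eval a300 a210 a201 a120 a111 a102 a030 a021 a012 a003.
    rewrite /G0 /G1 /G2 horner_tang0 horner_tang1 horner_tang2; ring.
  by rewrite eG1 eG2; ring.
pose v3 := - b 3 0 0 * s ^+ 2 + s * - (b 2 1 0 * t + b 2 0 1)
    - (b 1 2 0 * t ^+ 2 + b 1 1 1 * t + b 1 0 2).
have -> : cubic_eval b s t 1 = (vx c).[t] - s * v3.
  rewrite /cubic_eval b030 b021 b012 b003 /v3 horner_vx; ring.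
(* The factor of b_300 vanishes: it is the tangency form at its double root. *)
have Ek : G0 * v3 = s * (elim1 b c).[t] + (elim2 b c).[t]
    - b 3 0 0 * (G0 * s ^+ 2 + G1 * s + G2).
  rewrite /v3 /G0 /G1 /G2 horner_elim1 horner_elim2 horner_tang0 horner_tang1
    horner_tang2; ring.
apply: contraNneq Nt => e.
have {}e : (vx c).[t] = s * v3 by apply/eqP; rewrite -subr_eq0 e.
have -> : (sing_obstr b c).[t] =
    2 * (G0 * G0 * (vx c).[t]) - 2 * (G2 * (elim1 b c).[t]) + G1 * (elim2 b c).[t].
  by rewrite /sing_obstr hornerD [in LHS]hornerD hornerN !hornerM !hornerC.
rewrite e.
have -> : 2 * (G0 * G0 * (s * v3)) = 2 * s * G0 * (G0 * v3) by ring.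
by rewrite Ek eG1 eG2; apply/eqP; ring.
Qed.

(** * Double zeros of the coefficients of a form *)

(** The coefficient with exponents e of the derivative of T along the coordinate l. *)
Definition partial_coef (K : pzRingType) (T : nat -> nat -> nat -> K) (l : nat)
    (e : nat * nat * nat) : K :=
  let: (i, j, k) := e in
  match l with
  | 0%N => T i.+1 j k *+ i.+1
  | 1%N => T i j.+1 k *+ j.+1
  | _ => T i j k.+1 *+ k.+1
  end.

(** This order of the quadratic monomials, and that of the rows of the next
matrix, make the matrix of the example triangular. *)
Definition quadratic_exps : seq (nat * nat * nat) :=
  [:: (2, 0, 0); (1, 1, 0); (0, 0, 2); (0, 1, 1); (0, 2, 0); (1, 0, 1)]%N.

(** The rows are the quadratic forms a_z, a_y, b_y, b_z, c_z, a_x. *)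
Definition gradient_mx (K : pzRingType) (a b c : nat -> nat -> nat -> K) : 'M[K]_6 :=
  \matrix_(i, j) partial_coef
    (nth a [:: a; a; b; b; c; a] i) (nth 0%N [:: 2; 1; 1; 2; 2; 0]%N i)
    (nth (0, 0, 0)%N quadratic_exps j).

(** T vanishes to order at least two at p, tested along the lines through p: this
form is insensitive to linear changes of variables. *)
Definition double_point (K : comPzRingType) (T : nat -> nat -> nat -> K)
    (p : 'rV[K]_3) :=
  forall u : 'rV[K]_3, exists al be : K, forall t : K,
    cubic_eval T (p 0 0 + t * u 0 0) (p 0 1 + t * u 0 1) (p 0 2%:R + t * u 0 2%:R) =
      t ^+ 2 * al + t ^+ 3 * be.

(** The derivative at 0 of a cubic polynomial q is
(8 (q(1) - q(-1)) - (q(2) - q(-2))) / 12; it is applied to the restriction of T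
to the line through p in the direction l. *)
Lemma double_point_gradient (K : numFieldType) (T : nat -> nat -> nat -> K) p l :
  double_point T p -> (l < 3)%N ->
  \sum_(e <- quadratic_exps)
    partial_coef T l e * (p 0 0 ^+ e.1.1 * p 0 1 ^+ e.1.2 * p 0 2%:R ^+ e.2) = 0.
Proof.
move=> dp l3.
have [al [be E]] := dp (delta_mx 0 (Ordinal l3)).
have n12 : 12 != 0 :> K by rewrite pnatr_eq0.
apply: (mulfI n12); rewrite mulr0.
transitivity (8 * ((1 ^+ 2 * al + 1 ^+ 3 * be) - ((-1) ^+ 2 * al + (-1) ^+ 3 * be))
  - ((2 ^+ 2 * al + 2 ^+ 3 * be) - ((-2) ^+ 2 * al + (-2) ^+ 3 * be))); last by ring.
rewrite -!E !mxE /quadratic_exps !big_cons big_nil /cubic_eval /=.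
by case: l l3 {E} => [|[|[|//]]] l3; rewrite /=; ring.
Qed.

(** The six quadratic monomials evaluated at p form a nonzero vector, because it
contains the squares of the coordinates, and the matrix annihilates it. *)
Lemma gradient_mx_double_point (K : numFieldType) (a b c : nat -> nat -> nat -> K) p :
  p != 0 -> double_point a p -> double_point b p -> double_point c p ->
  \det (gradient_mx a b c) = 0.
Proof.
move=> p0 da db dc; apply/eqP; rewrite -det_tr; apply/det0P.
pose mon (e : nat * nat * nat) := p 0 0 ^+ e.1.1 * p 0 1 ^+ e.1.2 * p 0 2%:R ^+ e.2.
exists (\row_(j < 6) mon (nth (0, 0, 0)%N quadratic_exps j)).
  apply: contra p0 => /eqP/rowP e; apply/eqP/rowP => i; rewrite mxE.
  have := e (@Ordinal 6 0 erefl); have := e (@Ordinal 6 2 erefl).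
  have := e (@Ordinal 6 4 erefl); rewrite !mxE /mon /= !expr0 !mulr1 !mul1r.
  move=> /eqP; rewrite expf_eq0 => /eqP p1 /eqP; rewrite expf_eq0 => /eqP p2.
  move=> /eqP; rewrite expf_eq0 => /eqP p3.
  case: i => -[|[|[|//]]] i3; [rewrite -[RHS]p3|rewrite -[RHS]p1|rewrite -[RHS]p2];
    congr (p _ _); exact/val_inj.
apply/rowP=> i; rewrite !mxE.
have dT : double_point (nth a [:: a; a; b; b; c; a] i) p.
  by case: i => -[|[|[|[|[|[|//]]]]]].
have l3 : (nth 0 [:: 2; 1; 1; 2; 2; 0] i < 3)%N.
  by case: i {dT} => -[|[|[|[|[|[|//]]]]]].
rewrite -[RHS](double_point_gradient dT l3) (big_nth (0, 0, 0)%N) big_mkord.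
by apply: eq_bigr => j _; rewrite !mxE mulrC.
Qed.

(** * A form with nonvanishing determinants *)

Section Example.
Variable K : numFieldType.
(** The form of the vector field v = (z^2 + y z, x^2, x y). *)
Definition ex_dx (i j k : nat) : K :=
  ((1, 2, 0)%N == (i, j, k))%:R - ((2, 0, 1)%N == (i, j, k))%:R.
Definition ex_dy (i j k : nat) : K :=
  ((0, 0, 3)%N == (i, j, k))%:R + ((0, 1, 2)%N == (i, j, k))%:R
  - ((2, 1, 0)%N == (i, j, k))%:R.
Definition ex_dz (i j k : nat) : K :=
  ((3, 0, 0)%N == (i, j, k))%:R - ((0, 1, 2)%N == (i, j, k))%:R
  - ((0, 2, 1)%N == (i, j, k))%:R.

Lemma gradient_mx_example : \det (gradient_mx ex_dx ex_dy ex_dz) != 0.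
Proof.
rewrite det_trig; last first.
  apply/is_trig_mxP => i j ij; rewrite mxE.
  by case: i j ij => -[|[|[|[|[|[|//]]]]]] ? [[|[|[|[|[|[|//]]]]]] ?] //= _;
    rewrite /ex_dx /ex_dy /ex_dz /= ?subr0 ?addr0 ?mul0rn.
rewrite !big_ord_recl big_ord0 !mxE /= /ex_dx /ex_dy /ex_dz /=.
rewrite !(subr0, addr0, add0r, sub0r, mulr1, mulNrn).
by rewrite !mulf_eq0 !oppr_eq0 !pnatr_eq0.
Qed.

Lemma tang_res_example : tang_res ex_dy ex_dz != 0.
Proof.
rewrite /tang_res /ex_dy /ex_dz /=.
rewrite (_ : _ - _ = 1) ?oner_neq0 //; ring.
Qed.

Lemma tang_discr_example : tang_discr ex_dy ex_dz = 'X^4.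
Proof.
rewrite /tang_discr /tang0 /tang1 /tang2 /vy1 /vy2 /vz1 /vz2 /ex_dy /ex_dz /=.
rewrite !(subr0, addr0, add0r, sub0r, polyCN, polyC0, polyC1).
ring.
Qed.

Lemma sing_obstr_example : sing_obstr ex_dy ex_dz = 2%:P + 2%:P * 'X.
Proof.
rewrite /sing_obstr /elim1 /elim2 /tang0 /tang1 /tang2 /vy1 /vy2 /vz1 /vz2 /vx
  /ex_dy /ex_dz /=.
rewrite !(subr0, addr0, add0r, sub0r, polyCN, polyC0, polyC1).
ring.
Qed.

(** With q = X^4 and p = 2 + 2 X the Sylvester matrix is upper triangular, with
diagonal entries 2 and 1. *)
Lemma sylvester4_example :
  \det (sylvester4 (sing_obstr ex_dy ex_dz) (tang_discr ex_dy ex_dz)) != 0.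
Proof.
have X4 m : ~~ (m < 4)%N -> 'X^(m - 4) * 'X^4 = 'X^m :> {poly K}.
  by rewrite -leqNgt => m4; rewrite -exprD subnK.
rewrite tang_discr_example sing_obstr_example -det_tr det_trig; last first.
  apply/is_trig_mxP => i j ij; rewrite !mxE; case: ifPn => j4.
    by rewrite coefXnM ij.
  by rewrite (X4 _ j4) coefXn (ltn_eqF ij).
rewrite prodf_seq_neq0; apply/allP => i _ /=; rewrite !mxE; case: ifPn => i4.
  rewrite coefXnM ltnn subnn coefD coefMX coefC /= addr0.
  by rewrite pnatr_eq0.
by rewrite (X4 _ i4) coefXn eqxx oner_eq0.
Qed.

End Example.

(** * Torus degeneration at an inflection point *)

Section Degeneration.
Variable K : numFieldType.

Definition omega1_coef (l i j k : nat) : K :=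
  match l with
  | 0%N => ((2, 0, 1)%N == (i, j, k))%:R - ((0, 3, 0)%N == (i, j, k))%:R
  | 1%N => ((1, 2, 0)%N == (i, j, k))%:R
  | _ => - ((3, 0, 0)%N == (i, j, k))%:R
  end.

(** The exponents of the one-parameter group diag(1, eps, eps^3). *)
Definition weight (l : nat) : nat := nth 0%N [:: 0; 1; 3]%N l.

(** The coefficient of the rescaled form is a constant times
eps^(j + 3 k + weight l - 3).  Below the weight 3 it vanishes, by the
hypothesis on b and the Euler relation; at the weight 3 the choice of kap makes
it equal to that of omega1; above, it is at most eps times a constant. *)
Lemma degeneration_coef (T : nat -> nat -> nat -> nat -> K) (beta kap eps : K) l i j k :
  euler_rel (T 0%N) (T 1%N) (T 2%N) ->
  (forall x y, cubic_eval (T 1%N) x y 0 = beta * x * y ^+ 2) ->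
  beta != 0 -> T 2%N 3 0 0 != 0 -> kap = - beta / T 2%N 3 0 0 -> 0 < eps -> eps <= 1 ->
  (l < 3)%N -> (i + j + k = 3)%N ->
  `|omega1_coef l i j k - (beta * eps ^+ 3)^-1 *
    (nth 0 [:: 1; eps; kap * eps ^+ 3] l *
      (1 ^+ i * eps ^+ j * (kap * eps ^+ 3) ^+ k) * T l i j k)| <=
  eps * `|beta^-1 * kap ^+ (k + (l == 2)) * T l i j k|.
Proof.
move=> eul evb b0 c0 kE e0 e1 l3 ijk.
have k0 : kap != 0 by rewrite kE mulf_neq0 ?oppr_eq0 ?invr_eq0.
have E400 := eul 4 0 0 erefl; have E310 := eul 3 1 0 erefl.
have E301 := eul 3 0 1 erefl; have E220 := eul 2 2 0 erefl.
have E130 := eul 1 3 0 erefl; have E040 := eul 0 4 0 erefl.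
move: E400 E310 E301 E220 E130 E040; rewrite /= !add0r !addr0.
have opp2 (x y : K) : x + y = 0 -> x = - y by move/eqP; rewrite addr_eq0 => /eqP.
move=> a300 /opp2 a210 /opp2 a201 /opp2 a120 /opp2 a030 b030.
(* The values at (1, 0), (1, 1) and (1, -1) determine b(x, y, 0), since the
   coefficient of y^3 is zero by the Euler relation. *)
have b300 : T 1%N 3 0 0 = 0.
  transitivity (beta * 1 * 0 ^+ 2); last by ring.
  by rewrite -evb /cubic_eval; ring.
have b1 := evb 1 1; have b2 := evb 1 (-1).
rewrite /cubic_eval b300 b030 in b1 b2.
have b210 : T 1%N 2 1 0 = 0.
  have n2 : 2 != 0 :> K by rewrite pnatr_eq0.
  apply: (mulfI n2); rewrite mulr0.
  transitivity (beta * 1 * 1 ^+ 2 - beta * 1 * (- 1) ^+ 2); last by ring.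
  by rewrite -b1 -b2; ring.
have b120 : T 1%N 1 2 0 = beta.
  transitivity (beta * 1 * 1 ^+ 2); last by ring.
  by rewrite -b1 b210; ring.
have en0 : eps != 0 by rewrite gt_eqF.
set c' := beta^-1 * _ * _.
set e := (j + 3 * k + weight l)%N.
have -> : (beta * eps ^+ 3)^-1 * (nth 0 [:: 1; eps; kap * eps ^+ 3] l *
      (1 ^+ i * eps ^+ j * (kap * eps ^+ 3) ^+ k) * T l i j k) =
      c' * eps ^+ e / eps ^+ 3.
  rewrite expr1n mul1r exprMn -exprM invfM /c' /e !exprD mulrC.
  by case: l l3 {c' e} => [|[|[|//]]] _ /=; rewrite ?expr0 ?expr1; ring.
have [e3|e3] := leqP e 3.
  suff -> : c' * eps ^+ e = omega1_coef l i j k * eps ^+ 3.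
    by rewrite mulfK ?expf_neq0 // subrr normr0 mulr_ge0 // ltW.
  move: e3; rewrite /e /c' {e c'}.
  case: l l3 => [|[|[|//]]] _;
    case: i j k ijk => [|[|[|[|i]]]] [|[|[|[|j]]]] [|[|[|[|k]]]] //= _ _;
    rewrite ?a300 ?a210 ?a201 ?a120 ?a030 ?b300 ?b210 ?b120 ?b030
      /omega1_coef /weight /= ?oppr0 ?b300 ?b210 ?b120.
all: try by rewrite ?subrr ?mulr0 ?mul0r.
all: try by rewrite kE; field; rewrite ?b0 ?c0.
have -> : omega1_coef l i j k = 0.
  move: (e3); rewrite /e /weight {e c' e3}.
  case: l l3 => [|[|[|//]]] _;
    case: i j k ijk => [|[|[|[|i]]]] [|[|[|[|j]]]] [|[|[|[|k]]]] //= _ _;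
  by rewrite /omega1_coef /= ?subrr ?oppr0.
have -> : c' * eps ^+ e / eps ^+ 3 = eps * c' * eps ^+ (e - 4).
  rewrite -{1}(subnK e3) exprD; field.
  by rewrite en0.
rewrite sub0r normrN 2!normrM (ger0_norm (ltW e0)) (ger0_norm (exprn_ge0 _ (ltW e0))).
have e0' := ltW e0.
by rewrite ler_piMr ?mulr_ge0 ?exprn_ile1.
Qed.

End Degeneration.

(** * Homogeneous polynomial functions of the coefficients *)

Section PolynomialFunctions.
Variables (K : comNzRingType) (n : nat).
Implicit Types (f g : ('I_n -> K) -> K) (F G : ('I_n -> K) -> {poly K}).

(** Zariski closed sets are cut out by homogeneous polynomials in the coordinates.
To avoid writing the polynomial, functions are shown to be polynomial of given
degree through closure properties. *)
Definition homog_fun d f :=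
  exists2 p : mpoly n K, p \is ishomog1 d mdeg & forall u, meval u p = f u.

Lemma homog_fun_ext d f g : f =1 g -> homog_fun d f -> homog_fun d g.
Proof. by move=> fg [p hp pE]; exists p => // u; rewrite pE. Qed.

Lemma homog_fun0 d : homog_fun d (fun=> 0).
Proof. by exists 0; [exact: rpred0|move=> u; rewrite meval0]. Qed.

Lemma homog_funC x : homog_fun 0 (fun=> x).
Proof.
exists (mpolyC n x) => [|u]; last exact: mevalC.
by rewrite -[mpolyC n x]mulr1 mul_mpolyC rpredZ // dhomog1.
Qed.

Lemma homog_funX k : homog_fun 1 (fun u => u k).
Proof.
exists (mpolyX K (mnm1 k)) => [|u]; last exact: mevalXU.
by rewrite dhomogX /= mdeg1.
Qed.

Lemma homog_funD d f g :
  homog_fun d f -> homog_fun d g -> homog_fun d (fun u => f u + g u).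
Proof.
move=> [p hp pE] [q hq qE]; exists (p + q); first exact: rpredD.
by move=> u; rewrite mevalD pE qE.
Qed.

Lemma homog_funN d f : homog_fun d f -> homog_fun d (fun u => - f u).
Proof.
move=> [p hp pE]; exists (- p); first by rewrite rpredN.
by move=> u; rewrite mevalN pE.
Qed.

Lemma homog_funM d e f g :
  homog_fun d f -> homog_fun e g -> homog_fun (d + e) (fun u => f u * g u).
Proof.
move=> [p hp pE] [q hq qE]; exists (p * q); first exact: dhomogM.
by move=> u; rewrite mevalM pE qE.
Qed.

Lemma homog_fun_sum d (I : Type) (r : seq I) (P : pred I)
    (f : I -> ('I_n -> K) -> K) :
  (forall i, homog_fun d (f i)) -> homog_fun d (fun u => \sum_(i <- r | P i) f i u).
Proof.
move=> hf; elim: r => [|i r IHr].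
  by apply: homog_fun_ext (homog_fun0 d) => u; rewrite big_nil.
have := IHr; have := homog_funD (hf i) IHr.
case Pi: (P i) => hD h; [move: hD|move: h];
  by apply: homog_fun_ext => u; rewrite big_cons Pi.
Qed.

Lemma homog_fun_prod (I : Type) (r : seq I) (d : I -> nat)
    (f : I -> ('I_n -> K) -> K) :
  (forall i, homog_fun (d i) (f i)) ->
  homog_fun (\sum_(i <- r) d i) (fun u => \prod_(i <- r) f i u).
Proof.
move=> hf; elim: r => [|i r IHr].
  by rewrite big_nil; apply: homog_fun_ext (homog_funC 1) => u; rewrite big_nil.
rewrite big_cons; apply: homog_fun_ext (homog_funM (hf i) IHr) => u.
by rewrite big_cons.
Qed.

(** The entries may have a degree that depends on the row. *)
Lemma homog_fun_det m (d : 'I_m -> nat) (M : ('I_n -> K) -> 'M[K]_m) :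
  (forall i j, homog_fun (d i) (fun u => M u i j)) ->
  homog_fun (\sum_i d i) (fun u => \det (M u)).
Proof.
move=> hM; rewrite /determinant; apply: homog_fun_sum => s.
rewrite -[X in homog_fun X]add0n; apply: homog_funM; first exact: homog_funC.
by apply: homog_fun_prod => i; exact: hM.
Qed.

Definition homog_poly d F := forall i, homog_fun d (fun u => (F u)`_i).

Lemma homog_polyD d F G :
  homog_poly d F -> homog_poly d G -> homog_poly d (fun u => F u + G u).
Proof.
by move=> hF hG i; apply: homog_fun_ext (homog_funD (hF i) (hG i)) => u;
  rewrite coefD.
Qed.

Lemma homog_polyN d F : homog_poly d F -> homog_poly d (fun u => - F u).
Proof.
by move=> hF i; apply: homog_fun_ext (homog_funN (hF i)) => u; rewrite coefN.
Qed.

Lemma homog_polyM d e F G :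
  homog_poly d F -> homog_poly e G -> homog_poly (d + e) (fun u => F u * G u).
Proof.
move=> hF hG i.
have : homog_fun (d + e) (fun u => \sum_(j < i.+1) (F u)`_j * (G u)`_(i - j)).
  by apply: homog_fun_sum => j; apply: homog_funM.
by apply: homog_fun_ext => u; rewrite coefM.
Qed.

Lemma homog_polyC d f : homog_fun d f -> homog_poly d (fun u => (f u)%:P).
Proof.
move=> hf [|i].
  by apply: homog_fun_ext hf => u; rewrite coefC.
by apply: homog_fun_ext (homog_fun0 d) => u; rewrite coefC.
Qed.

Lemma homog_poly_cst (p : {poly K}) : homog_poly 0 (fun=> p).
Proof. by move=> i; exact: homog_funC. Qed.

Lemma homog_polyMl d (p : {poly K}) F :
  homog_poly d F -> homog_poly d (fun u => p * F u).
Proof. by move=> hF; have := homog_polyM (homog_poly_cst p) hF. Qed.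

Lemma homog_polyMr d (p : {poly K}) F :
  homog_poly d F -> homog_poly d (fun u => F u * p).
Proof. by move=> hF; have := homog_polyM hF (homog_poly_cst p); rewrite addn0. Qed.

Section Forms.
Variables (a b c : ('I_n -> K) -> nat -> nat -> nat -> K).
Hypothesis ha : forall i j k, homog_fun 1 (fun u => a u i j k).
Hypothesis hb : forall i j k, homog_fun 1 (fun u => b u i j k).
Hypothesis hc : forall i j k, homog_fun 1 (fun u => c u i j k).

Let hbP i j k := homog_polyC (hb i j k).
Let hcP i j k := homog_polyC (hc i j k).

Let htang0 : homog_poly 1 (fun u => tang0 (b u) (c u)).
Proof.
by apply: homog_polyD; [apply: homog_polyMr; apply: homog_polyN|apply: homog_polyN].
Qed.

Let lin (F G : ('I_n -> K) -> {poly K}) : homog_poly 1 F -> homog_poly 1 G ->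
  homog_poly 1 (fun u => F u * 'X + G u).
Proof. by move=> hF hG; apply: homog_polyD => //; apply: homog_polyMr. Qed.

Let quad (F G H : ('I_n -> K) -> {poly K}) :
  homog_poly 1 F -> homog_poly 1 G -> homog_poly 1 H ->
  homog_poly 1 (fun u => F u * 'X^2 + G u * 'X + H u).
Proof.
by move=> hF hG hH; apply: homog_polyD => //; apply: homog_polyD; apply: homog_polyMr.
Qed.

Let hvy1 : homog_poly 1 (fun u => vy1 (c u)).
Proof. exact: lin. Qed.
Let hvy2 : homog_poly 1 (fun u => vy2 (c u)).
Proof. exact: quad. Qed.
Let hvz1 : homog_poly 1 (fun u => vz1 (b u)).
Proof. apply: homog_polyN; exact: lin. Qed.
Let hvz2 : homog_poly 1 (fun u => vz2 (b u)).
Proof. apply: homog_polyN; exact: quad. Qed.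
Let hvx : homog_poly 1 (fun u => vx (c u)).
Proof. apply: homog_polyN; exact: quad. Qed.
Let htang1 : homog_poly 1 (fun u => tang1 (b u) (c u)).
Proof. by apply: homog_polyD; [apply: homog_polyMl|apply: homog_polyN]. Qed.
Let htang2 : homog_poly 1 (fun u => tang2 (b u) (c u)).
Proof. by apply: homog_polyD; [apply: homog_polyMl|apply: homog_polyN]. Qed.
Let helim1 : homog_poly 2 (fun u => elim1 (b u) (c u)).
Proof.
apply: homog_polyD; last apply: homog_polyN; apply: (homog_polyM (d := 1)) => //.
exact: homog_polyN.
Qed.
Let helim2 : homog_poly 2 (fun u => elim2 (b u) (c u)).
Proof.
apply: homog_polyD; last apply: homog_polyN; apply: (homog_polyM (d := 1)) => //.
exact: homog_polyN.
Qed.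

Let hdiscr : homog_poly 2 (fun u => tang_discr (b u) (c u)).
Proof.
apply: homog_polyD; first exact: (homog_polyM (d := 1)).
by apply: homog_polyN; apply: homog_polyMl; apply: (homog_polyM (d := 1)).
Qed.

Let hobstr : homog_poly 3 (fun u => sing_obstr (b u) (c u)).
Proof.
apply: homog_polyD; last exact: (homog_polyM (d := 1)).
apply: homog_polyD.
  apply: homog_polyMl; apply: (homog_polyM (d := 2)) => //.
  exact: (homog_polyM (d := 1)).
by apply: homog_polyN; apply: homog_polyMl; apply: (homog_polyM (d := 1)).
Qed.

Lemma homog_tang_res : homog_fun 3 (fun u => tang_res (b u) (c u)).
Proof.
rewrite /tang_res; apply: homog_funD; last first.
  by apply: homog_funN; apply: (homog_funM (d := 1)) => //; apply: (homog_funM (d := 1)).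
apply: homog_funD.
  by apply: (homog_funM (d := 1)); [apply: homog_funN|apply: (homog_funM (d := 1))].
apply: homog_funN; apply: (homog_funM (d := 1)); last exact: (homog_funM (d := 1)).
by apply: homog_funD; apply: homog_funN.
Qed.

Lemma homog_tang_discr_lead : homog_fun 2 (fun u => (tang_discr (b u) (c u))`_4).
Proof. exact: hdiscr. Qed.

Lemma homog_sylvester : homog_fun (\sum_(i < 8) if (i < 4)%N then 3 else 2)%N
  (fun u => \det (sylvester4 (sing_obstr (b u) (c u)) (tang_discr (b u) (c u)))).
Proof.
apply: homog_fun_det => i j.
have : homog_fun (if (i < 4)%N then 3 else 2)%N (fun u => (if (i < 4)%N then
   'X^i * sing_obstr (b u) (c u) else 'X^(i - 4) * tang_discr (b u) (c u))`_j).
  by case: ifP => _; exact: homog_polyMl.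
by apply: homog_fun_ext => u; rewrite mxE.
Qed.

Lemma homog_gradient_mx : homog_fun (\sum_(i < 6) 1)%N
  (fun u => \det (gradient_mx (a u) (b u) (c u))).
Proof.
apply: homog_fun_det => i j.
set e := nth (0, 0, 0)%N quadratic_exps j; set l := nth 0%N [:: 2; 1; 1; 2; 2; 0]%N i.
have hd T : (forall i j k, homog_fun 1 (fun u => T u i j k)) ->
    homog_fun 1 (fun u => partial_coef (T u) l e).
  move=> hT; have hMn m i' j' k' : homog_fun 1 (fun u => T u i' j' k' *+ m).
    rewrite -[X in homog_fun X]addn0.
    apply: homog_fun_ext (homog_funM (hT i' j' k') (homog_funC m%:R)) => u.
    by rewrite mulr_natr.
  by rewrite /partial_coef; case: e => -[i' j'] k'; case: l => [|[|?]]; exact: hMn.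
have : homog_fun 1 (fun u => partial_coef (nth a [:: a; a; b; b; c; a] i u) l e).
  by apply: hd; case: (i) => -[|[|[|[|[|[|//]]]]]].
apply: homog_fun_ext => u; rewrite mxE; congr partial_coef.
by case: (i) => -[|[|[|[|[|[|//]]]]]].
Qed.

Definition exceptional_fun (u : 'I_n -> K) : K :=
  tang_res (b u) (c u) * (tang_discr (b u) (c u))`_4
  * \det (sylvester4 (sing_obstr (b u) (c u)) (tang_discr (b u) (c u)))
  * \det (gradient_mx (a u) (b u) (c u)).

Lemma homog_exceptional_fun : exists d, homog_fun d exceptional_fun.
Proof.
eexists; apply: homog_funM homog_gradient_mx; apply: homog_funM homog_sylvester.
exact: homog_funM homog_tang_res homog_tang_discr_lead.
Qed.

End Forms.
End PolynomialFunctions.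

(** * Cubic polynomials in three variables and linear substitutions *)

Lemma sum3 (V : nmodType) (F : 'I_3 -> V) :
  \sum_i F i = F 0 + F 1 + F 2%:R.
Proof.
rewrite !big_ord_recl big_ord0 addr0 addrA.
by congr (_ + F _ + F _); apply/val_inj.
Qed.

Lemma ord3P (i : 'I_3) : [\/ i = 0, i = 1 | i = 2%:R].
Proof.
case: i => -[|[|[|//]]] lt_i3; [constructor 1|constructor 2|constructor 3];
  exact/val_inj.
Qed.

Lemma prod3 (K : comPzSemiRingType) (F : 'I_3 -> K) :
  \prod_i F i = F 0 * F 1 * F 2%:R.
Proof.
rewrite !big_ord_recl big_ord0 mulr1 mulrA.
by congr (_ * F _ * F _); apply/val_inj.
Qed.

(** Exponents of monomials in three variables. *)
Definition mon3 (i j k : nat) : multinom 3 := Multinom [tuple i; j; k].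

Lemma mon3E (m : multinom 3) : m = mon3 (m 0%R) (m 1%R) (m 2%:R%R).
Proof. by apply/mnmP=> i; have [->|->|->] := ord3P i; rewrite !mnm_tnth. Qed.

Lemma mdeg3 (m : multinom 3) : mdeg m = (m 0%R + m 1%R + m 2%:R%R)%N.
Proof. by rewrite {1}[m]mon3E /mdeg /= !big_cons big_nil addn0 addnA. Qed.

Lemma mon3_eq i j k i' j' k' :
  (mon3 i j k == mon3 i' j' k') = [&& i == i', j == j' & k == k'].
Proof.
by rewrite -val_eqE /= -val_eqE /= !eqseq_cons andbT.
Qed.

Definition cubic_exps : seq (multinom 3) :=
  [:: mon3 3 0 0; mon3 2 1 0; mon3 2 0 1; mon3 1 2 0; mon3 1 1 1; mon3 1 0 2;
      mon3 0 3 0; mon3 0 2 1; mon3 0 1 2; mon3 0 0 3].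

Lemma cubic_exps_uniq : uniq cubic_exps.
Proof. by []. Qed.

Lemma mem_cubic_exps m : mdeg m = 3%N -> m \in cubic_exps.
Proof.
rewrite mdeg3; have := mon3E m.
move: (m 0%R) (m 1%R) (m 2%:R%R) => a b c -> {m}.
by case: a b c => [|[|[|[|a]]]] [|[|[|[|b]]]] [|[|[|[|c]]]] //=;
  rewrite ?addnS.
Qed.

Section Mpoly3.
Variable R : realType.
Local Notation C := (complex_field R).
Local Notation poly3 := (mpoly 3 C).
Implicit Types (p q : poly3) (v : 'I_3 -> C).

Lemma Xvar3 i j k : Xvar R 0 ^+ i * Xvar R 1 ^+ j * Xvar R 2%:R ^+ k =
  mpolyX C (mon3 i j k).
Proof.
rewrite [in RHS]mpolyXE_id prod3 /Xvar; congr (_ ^+ _ * _ ^+ _ * _ ^+ _).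
Qed.

(** The coefficients of p in the encoding of [cubic_eval]. *)
Definition coef3 p i j k : C := mcoeff (mon3 i j k) p.

Lemma cubicE p : p \is ishomog1 3 mdeg ->
  p = \sum_(m <- cubic_exps) mcoeff m p *: mpolyX C m.
Proof.
move=> /dhomogP hom_p; apply/mpolyP=> m; rewrite raddf_sum /=.
under eq_bigr do rewrite mcoeffZ mcoeffX.
have [mL|mL] := boolP (m \in cubic_exps).
  rewrite (bigD1_seq m) ?cubic_exps_uniq //= eqxx mulr1 big1 ?addr0 //.
  by move=> m' /negPf ->; rewrite mulr0.
rewrite big1_seq => [|m' /andP[_ m'L]].
  apply/eqP; rewrite mcoeff_eq0; apply: contra mL => /hom_p.
  exact: mem_cubic_exps.
have [e|_] := eqVneq m' m; last by rewrite mulr0.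
by rewrite -e m'L in mL.
Qed.

Lemma meval_cubic p v : p \is ishomog1 3 mdeg ->
  meval v p = cubic_eval (coef3 p) (v 0) (v 1) (v 2%:R).
Proof.
have mevalM3 i j k :
    meval v (mpolyX C (mon3 i j k)) = v 0 ^+ i * v 1 ^+ j * v 2%:R ^+ k.
  by rewrite -Xvar3 !rmorphM !rmorphXn /= !mevalXU.
move=> /cubicE {1}->; rewrite raddf_sum /=.
under eq_bigr do rewrite mevalZ.
by rewrite /cubic_exps !big_cons big_nil -cubic_eval_sum !mevalM3.
Qed.

Lemma mcoeff_mulX p (i : 'I_3) (m : multinom 3) :
  mcoeff m (p * Xvar R i) =
  if (0 < m i)%N then mcoeff (mnm_sub m (mnm1 i)) p else 0.
Proof.
case: ifPn => [mi|mi].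
  have {1}-> : m = mnm_add (mnm1 i) (mnm_sub m (mnm1 i)); last exact: mcoeffMX.
  apply/mnmP=> j; rewrite mnmDE mnmBE mnm1E; case: eqP => [<-|_] /=.
    by rewrite add1n subn1 prednK.
  by rewrite add0n subn0.
rewrite {1}[p]mpolyE mulr_suml raddf_sum /= big1 // => m' _.
rewrite -scalerAl mcoeffZ -mpolyXD mcoeffX.
case: eqP => [e|_]; last by rewrite mulr0.
by move: mi; rewrite -e mnmDE mnm1E eqxx addn1.
Qed.

Implicit Types (w : one_form R) (A B : 'M[C]_3).

Definition subst_lin A : 3.-tuple poly3 :=
  [tuple \sum_j mpolyC 3 (A i j) * Xvar R j | i < 3].

Lemma pullbackE A w i :
  pullback A w 0 i = \sum_k A k i *: comp_mpoly (subst_lin A) (w 0 k).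
Proof.
rewrite mxE; apply: eq_bigr => k _.
by rewrite !mxE mulrC mul_mpolyC.
Qed.

Lemma comp_subst_Xvar A i :
  comp_mpoly (subst_lin A) (Xvar R i) = \sum_j A i j *: Xvar R j.
Proof.
rewrite /comp_mpoly mmapX mmap1U tnth_mktuple.
by apply: eq_bigr => j _; rewrite mul_mpolyC.
Qed.

Lemma meval_pullback A w i v :
  meval v (pullback A w 0 i) =
  \sum_k A k i * meval (fun l => \sum_j A l j * v j) (w 0 k).
Proof.
rewrite pullbackE raddf_sum; apply: eq_bigr => k _ /=.
rewrite mevalZ comp_mpoly_meval; congr (_ * _).
apply: meval_eq => l; rewrite tnth_mktuple raddf_sum /=.
by apply: eq_bigr => j _; rewrite mevalM mevalC mevalXU.
Qed.

(** Ring morphisms out of a polynomial ring are determined by the constants and the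
variables. *)
Lemma comp_mpoly_ext (f g : {rmorphism poly3 -> poly3}) :
  (forall c, f (mpolyC 3 c) = g (mpolyC 3 c)) ->
  (forall i, f (Xvar R i) = g (Xvar R i)) -> f =1 g.
Proof.
move=> fgC fgX p; rewrite [p]mpolyE !raddf_sum; apply: eq_bigr => m _ /=.
rewrite -mul_mpolyC !rmorphM /= fgC mpolyXE_id !rmorph_prod /=; congr (_ * _).
by apply: eq_bigr => i _; rewrite !rmorphXn /= fgX.
Qed.

Lemma comp_subst A B p :
  comp_mpoly (subst_lin B) (comp_mpoly (subst_lin A) p) =
  comp_mpoly (subst_lin (A *m B)) p.
Proof.
apply: (@comp_mpoly_ext (comp_mpoly (subst_lin B) \o comp_mpoly (subst_lin A))
  (comp_mpoly (subst_lin (A *m B)))) => [c|i] /=.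
  by rewrite !comp_mpolyC.
rewrite !comp_subst_Xvar raddf_sum /=.
under eq_bigr do rewrite linearZ /= comp_subst_Xvar scaler_sumr.
rewrite exchange_big; apply: eq_bigr => j _ /=.
by rewrite mxE scaler_suml; apply: eq_bigr => k _; rewrite scalerA.
Qed.

Lemma comp_subst1 p : comp_mpoly (subst_lin 1%:M) p = p.
Proof.
apply: (@comp_mpoly_ext (comp_mpoly (subst_lin 1%:M)) idfun) => [c|i] /=.
  by rewrite comp_mpolyC.
rewrite comp_subst_Xvar (bigD1 i) //= mxE eqxx scale1r big1 ?addr0 // => j ij.
by rewrite mxE eq_sym (negPf ij) scale0r.
Qed.

Lemma subst_pullback A B w k :
  comp_mpoly (subst_lin B) (pullback A w 0 k) =
  \sum_j A j k *: comp_mpoly (subst_lin (A *m B)) (w 0 j).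
Proof.
rewrite pullbackE (raddf_sum (comp_mpoly (subst_lin B))).
by apply: eq_bigr => j _ /=; rewrite comp_mpolyZ comp_subst.
Qed.

Lemma pullback_comp A B w : pullback B (pullback A w) = pullback (A *m B) w.
Proof.
apply/rowP=> i; rewrite [LHS]pullbackE [RHS]pullbackE.
transitivity (\sum_k \sum_j (B k i * A j k) *: comp_mpoly (subst_lin (A *m B)) (w 0 j)).
  apply: eq_bigr => k _.
  rewrite subst_pullback scaler_sumr.
  by apply: eq_bigr => j _; rewrite scalerA.
rewrite exchange_big; apply: eq_bigr => k _ /=.
rewrite mxE scaler_suml; apply: eq_bigr => j _.
by rewrite mulrC.
Qed.

Lemma pullback1 w : pullback 1%:M w = w.
Proof.
apply/rowP=> i; rewrite pullbackE (bigD1 i) //= mxE eqxx scale1r comp_subst1.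
rewrite big1 ?addr0 // => j ij.
by rewrite mxE (negPf ij) scale0r.
Qed.

Lemma pullback0 A : pullback A (0 : one_form R) = 0.
Proof.
apply/rowP=> i; rewrite pullbackE mxE big1 // => k _.
by rewrite mxE raddf0 scaler0.
Qed.

Lemma pullback_cubic A w : A \in unitmx ->
  is_cubic_form w -> is_cubic_form (pullback A w).
Proof.
move=> uA /and3P[w0 /forallP hom_w /eqP euler_w]; apply/and3P; split.
- apply: contra w0 => /eqP e; apply/eqP.
  by rewrite -[w]pullback1 -(mulmxV uA) -pullback_comp e pullback0.
- apply/forallP=> i; rewrite pullbackE; apply: rpred_sum => k _; apply: rpredZ.
  rewrite comp_mpolyE big_seq; apply: rpred_sum => m /(dhomogP _ _ _ (hom_w k)) deg_m.
  apply: rpredZ; rewrite prod3.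
  have hom_l j e : tnth (subst_lin A) j ^+ e \is ishomog1 e mdeg.
    have := @dhomogMn _ _ mdeg 1 (tnth (subst_lin A) j) e; rewrite mul1n; apply.
    rewrite tnth_mktuple; apply: rpred_sum => l _.
    rewrite mul_mpolyC; apply: rpredZ.
    by rewrite dhomogX /= mdeg1.
  have := dhomogM (dhomogM (hom_l 0 (m 0%R)) (hom_l 1 (m 1%R)))
    (hom_l 2%:R (m 2%:R%R)).
  by rewrite -mdeg3 deg_m.
apply/eqP; transitivity (comp_mpoly (subst_lin A) (\sum_i w 0 i * Xvar R i)).
  transitivity (\sum_i \sum_k A k i *: comp_mpoly (subst_lin A) (w 0 k) * Xvar R i).
    by apply: eq_bigr => i _; rewrite pullbackE mulr_suml.
  rewrite exchange_big (raddf_sum (comp_mpoly (subst_lin A))).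
  apply: eq_bigr => k _ /=.
  rewrite (rmorphM (comp_mpoly (subst_lin A))) /= comp_subst_Xvar mulr_sumr.
  by apply: eq_bigr => i _; rewrite -scalerAl -scalerAr.
by rewrite euler_w raddf0.
Qed.

(** A common factor of the pullback, transported by the inverse matrix, becomes a
common factor of the original form. *)
Lemma pullback_no_common_factor A w : A \in unitmx ->
  no_common_factor w -> no_common_factor (pullback A w).
Proof.
move=> uA cop_w d d_dvd.
have cop : comp_mpoly (subst_lin (invmx A)) d \is a GRing.unit.
  apply: cop_w => i; exists (\sum_k (invmx A) k i *:
    comp_mpoly (subst_lin (invmx A)) (projT1 (cid (d_dvd k)))).
  rewrite -{1}[w]pullback1 -(mulmxV uA) -pullback_comp.
  rewrite [LHS]pullbackE mulr_sumr.
  apply: eq_bigr => k _; case: cid => q /= ->.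
  by rewrite rmorphM /= scalerAr.
rewrite -[d]comp_subst1 -(mulVmx uA) -comp_subst.
exact: (rmorph_unit (comp_mpoly (subst_lin A))).
Qed.

Lemma mcoeff_pullback_diag (d : 'rV[C]_3) w i (m : multinom 3) :
  mcoeff m (pullback (diag_mx d) w 0 i) =
  d 0 i * (\prod_j d 0 j ^+ m j) * mcoeff m (w 0 i).
Proof.
have diagX j : comp_mpoly (subst_lin (diag_mx d)) (Xvar R j) = d 0 j *: Xvar R j.
  rewrite comp_subst_Xvar (bigD1 j) //= !mxE eqxx mulr1n big1 ?addr0 // => k jk.
  by rewrite !mxE eq_sym (negPf jk) mulr0n scale0r.
rewrite pullbackE (bigD1 i) //= [X in _ + X]big1 => [|k ki]; last first.
  by rewrite !mxE (negPf ki) mulr0n scale0r.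
rewrite !mxE eqxx mulr1n addr0 mcoeffZ -mulrA; congr (_ * _).
rewrite comp_mpolyEX raddf_sum /=.
have monE m' : mcoeff m (comp_mpoly (subst_lin (diag_mx d)) (mpolyX C m')) =
   (\prod_j d 0 j ^+ m' j) * (m' == m)%:R.
  rewrite mpolyXE_id rmorph_prod /=.
  under eq_bigr do rewrite rmorphXn /= diagX exprZn.
  by rewrite scaler_prod mcoeffZ -mpolyXE_id mcoeffX.
under eq_bigr do rewrite mcoeffZ monE.
have [mw|mw] := boolP (m \in msupp (w 0 i)).
  rewrite (bigD1_seq m) ?msupp_uniq //= eqxx mulr1 mulrC.
  rewrite [X in _ + X]big1 ?addr0 // => m' /negPf ->.
  by rewrite !mulr0.
rewrite [in RHS](memN_msupp_eq0 mw) mulr0 big1_seq // => m' /andP[_ m'w].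
by case: eqP => [e|_]; rewrite ?mulr0 //; rewrite -e m'w in mw.
Qed.

(** Leading monomials multiply and the monomial order is graded, so the leading
monomial of a common divisor divides two coprime monomials: it is 1, and the
divisor is a constant. *)
Lemma coprime_mlead (d f h q r : poly3) : f != 0 -> h != 0 ->
  f = d * q -> h = d * r ->
  (forall i, mlead f i = 0%N \/ mlead h i = 0%N) -> d \is a GRing.unit.
Proof.
move=> f0 h0 Ef Eh cop.
have [d0 q0] : d != 0 /\ q != 0 by apply/andP; rewrite -negb_or -mulf_eq0 -Ef.
have r0 : r != 0 by apply: contraNneq h0 => r0; rewrite Eh r0 mulr0.
have lead_d : mlead d = mnm0.
  apply/mnmP=> i; rewrite mnm0E.
  case: (cop i); rewrite ?Ef ?Eh mleadM // mnmDE => /eqP;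
    by rewrite addn_eq0 => /andP[/eqP].
have /eqP/msize_poly1P[c c0 ->] : msize d = 1%N.
  by rewrite -mlead_deg // lead_d mdeg0.
by rewrite rmorph_unit // unitfE.
Qed.

End Mpoly3.

(** * The projective space of forms *)

Section Projective.
Variable R : realType.
Local Notation C := (complex_field R).
Implicit Types (w : form_space R).

Lemma proj_classP w w' : reflect (proj_class w = proj_class w') (proportional w w').
Proof.
exact: (@eqmodP _ (proportional_equiv_rel R) w w').
Qed.

Lemma proj_class_continuous : continuous (@proj_class R).
Proof. exact: pi_continuous. Qed.

Lemma nbhs_proj_class w (B : set (P14 R)) : nbhs (proj_class w) B ->
  exists2 e : C, 0 < e & forall w',
    (forall k, `|coords w 0 k - coords w' 0 k| < e) -> B (proj_class w').
Proof.
move=> nB; have : nbhs w (@proj_class R @^-1` B) by exact: proj_class_continuous.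
rewrite nbhsE => -[O [[V oV <-] /= Vw] OB].
have /nbhs_ballP[e /= e0 eV] : nbhs (coords w) V by exact: open_nbhs_nbhs.
exists e => // w' ww'; apply: OB; apply: eV; split=> // i k.
by rewrite (ord1 i) -ball_normE /=.
Qed.

(** The topology of F(2;2) is induced from a quotient of an initial topology:
a neighbourhood of a class contains the classes of all the forms with close
coefficients. *)
Lemma closure_in_F22P (A : set (P14 R)) w : F22 R (proj_class w) ->
  (forall e : C, 0 < e -> exists2 w' : form_space R,
     (A (proj_class w') /\ F22 R (proj_class w')) &
     forall k, `|coords w 0 k - coords w' 0 k| < e) ->
  closure_in_F22 A (proj_class w).
Proof.
move=> Fw hA B nB.
have : within (F22 R) (nbhs (proj_class w)) B by rewrite nbhs_subspace_in.
move=> /nbhs_proj_class[e e0 eB].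
have [w' [Aw' Fw'] ww'] := hA e e0.
by exists (proj_class w'); split=> //; exact: eB.
Qed.

End Projective.

(** * Coefficients of cubic forms; the form omega1 *)

Section CubicForms.
Variable R : realType.
Local Notation C := (complex_field R).
Implicit Types (w : form_space R).

(** The coefficients along dX, dY, dZ, for l = 0, 1, 2. *)
Definition form_coef (w : one_form R) (l : nat) : nat -> nat -> nat -> C :=
  coef3 (w 0 (inZp l)).

Lemma coef3_mon a b c i j k :
  coef3 (mpolyX C (mon3 a b c)) i j k = ((a, b, c) == (i, j, k))%:R.
Proof. by rewrite /coef3 mcoeffX mon3_eq !xpair_eqE andbA. Qed.

Lemma mon3_sub i j k (l : 'I_3) : mnm_sub (mon3 i j k) (mnm1 l) =
  mon3 (i - (l == 0)) (j - (l == 1)) (k - (l == 2%:R)).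
Proof.
by apply/mnmP => m; rewrite mnmBE mnm1E; have [->|->|->] := ord3P m; rewrite !mnm_tnth.
Qed.

Lemma euler_coef (w : one_form R) : is_cubic_form w ->
  euler_rel (form_coef w 0) (form_coef w 1) (form_coef w 2).
Proof.
move=> /and3P[_ _ /eqP ew] i j k _.
have e0 : inZp 0 = 0 :> 'I_3 by exact/val_inj.
have e1 : inZp 1 = 1 :> 'I_3 by exact/val_inj.
have e2 : inZp 2 = 2%:R :> 'I_3 by exact/val_inj.
have : mcoeff (mon3 i j k) (\sum_i w 0 i * Xvar R i) = 0 by rewrite ew mcoeff0.
rewrite sum3 !mcoeffD !mcoeff_mulX !mnm_tnth /= !mon3_sub !subn0 !subn1.
by rewrite /form_coef /coef3 e0 e1 e2.
Qed.

Lemma proportionalP w w' : proj_class w = proj_class w' ->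
  exists2 c : C, c != 0 & forall i, val w' 0 i = c *: val w 0 i.
Proof. by move/proj_classP/asboolP. Qed.

Lemma scale_cubic (c : C) (w : one_form R) : c != 0 -> is_cubic_form w ->
  is_cubic_form (\row_i (c *: w 0 i)).
Proof.
move=> c0 /and3P[w0 /forallP hw /eqP ew]; apply/and3P; split.
- apply: contra w0 => /eqP/rowP e; apply/eqP/rowP => i.
  by have := e i; rewrite !mxE => /eqP; rewrite scaler_eq0 (negPf c0) => /eqP.
- by apply/forallP => i; rewrite mxE rpredZ.
apply/eqP; transitivity (c *: \sum_i w 0 i * Xvar R i).
  by rewrite scaler_sumr; apply: eq_bigr => i _; rewrite mxE scalerAl.
by rewrite ew scaler0.
Qed.

Lemma scale_form (c : C) w : c != 0 ->
  exists2 w' : form_space R, proj_class w' = proj_class w &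
    forall i, val w' 0 i = c *: val w 0 i.
Proof.
move=> c0; exists (exist (fun v => is_cubic_form v) _ (scale_cubic c0 (valP w))) => [|i];
  last by rewrite mxE.
apply/esym/proj_classP/asboolP; exists c => // i.
by rewrite mxE.
Qed.

Lemma no_common_factorZ (c : C) (w w' : one_form R) : c != 0 ->
  (forall i, w' 0 i = c *: w 0 i) -> no_common_factor w -> no_common_factor w'.
Proof.
move=> c0 ww' cw d hd; apply: cw => i; have [q e] := hd i.
exists (c^-1 *: q); rewrite -scalerAr -e ww' scalerA mulVf ?scale1r //.
Qed.

(** Absence of a common factor depends only on the class of the form. *)
Lemma F22P w : F22 R (proj_class w) <-> no_common_factor (val w).
Proof.
split=> [[w' /proportionalP[c c0 e] cw']|cw]; last by exists w.
exact: no_common_factorZ c0 e cw'.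
Qed.

Lemma pullbackZ (c : C) A (w w' : one_form R) :
  (forall i, w' 0 i = c *: w 0 i) ->
  forall i, pullback A w' 0 i = c *: pullback A w 0 i.
Proof.
move=> e i; rewrite [LHS]pullbackE [X in _ *: X]pullbackE scaler_sumr.
by apply: eq_bigr => k _; rewrite e comp_mpolyZ !scalerA mulrC.
Qed.

Lemma mon3_lt0 i j k i' j' k' : (i + j + k = i' + j' + k')%N -> (i < i')%N ->
  (mon3 i j k < mon3 i' j' k')%O.
Proof.
move=> e ii'; apply/ltmcP; first by rewrite !mdeg3 !mnm_tnth.
by exists 0 => //.
Qed.

Local Notation M i j k := (mpolyX C (mon3 i j k)).

Lemma omega1E : [/\ omega1 R 0 0 = M 2 0 1 - M 0 3 0, omega1 R 0 1 = M 1 2 0 &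
  omega1 R 0 2%:R = - M 3 0 0].
Proof.
by split; rewrite mxE /= -?Xvar3 ?expr0 ?expr1 ?mulr1 ?mul1r.
Qed.

Lemma mulX_mon3 i j k i' j' k' : M i j k * M i' j' k' = M (i + i') (j + j') (k + k').
Proof.
rewrite -mpolyXD; congr mpolyX; apply/mnmP => l.
by rewrite mnmDE; have [->|->|->] := ord3P l; rewrite !mnm_tnth.
Qed.

(** The ideal of the coefficients contains X^3 and
Y^5 = X Z (X Y^2) - Y^2 (X^2 Z - Y^3). *)
Lemma omega1_no_common_factor : no_common_factor (omega1 R).
Proof.
move=> d hd; have [E0 E1 E2] := omega1E.
have [q0] := hd 0; rewrite E0 => e0; have [q1] := hd 1; rewrite E1 => e1.
have [q2] := hd 2%:R; rewrite E2 => e2.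
have X0 (m : multinom 3) : mpolyX C m != 0 by rewrite -msupp_eq0 msuppX.
apply: (@coprime_mlead R d (M 3 0 0) (M 0 5 0) (- q2) (M 1 0 1 * q1 - M 0 2 0 * q0)) => //.
- by rewrite mulrN -e2 opprK.
- by rewrite mulrBr mulrCA -e1 mulrCA -e0 mulrBr !mulX_mon3 opprB addrC subrK.
by move=> i; rewrite !mleadXm; have [->|->|->] := ord3P i; rewrite !mnm_tnth; [right|left|left].
Qed.

End CubicForms.

(** * The polynomial defining the exceptional set *)

Section ExceptionalPolynomial.
Variable R : realType.
Local Notation C := (complex_field R).
Local Notation M i j k := (mpolyX C (mon3 i j k)).
Implicit Types (w : form_space R).

(** The coefficients of a form as functions of its coordinates; the value 0 is taken
outside the exponents of cubic monomials. *)
Definition coord_coef (u : 'I_#|form_index| -> C) (l i j k : nat) : C :=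
  if (insub (mon3 i j k) : option (bmultinom 3 4)) is Some m then
    if (insub m : option {m : bmultinom 3 4 | mdeg (val m) == 3%N}) is Some m'
    then u (enum_rank (inZp l, m')) else 0
  else 0.

Lemma coord_coefE w l : coord_coef (coords w 0) l = form_coef (val w) l.
Proof.
apply/funext => i; apply/funext => j; apply/funext => k.
have /and3P[_ /forallP/(_ (inZp l)) hw _] := valP w.
have coef0 : mdeg (mon3 i j k) != 3%N -> 0 = form_coef (val w) l i j k.
  by move=> m3; rewrite /form_coef /coef3 (dhomog_nemf_coeff hw m3).
rewrite /coord_coef; case: insubP => [m _ Em|m4]; last first.
  by apply: coef0; apply: contraNneq m4 => ->.
case: insubP => [m' _ Em'|m3]; last by apply: coef0; rewrite -Em.
by rewrite mxE enum_rankK /= Em' Em.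
Qed.

Lemma homog_coord_coef l i j k : homog_fun 1 (fun u => coord_coef u l i j k).
Proof.
rewrite /coord_coef; case: insubP => [m _ _|_]; last exact: homog_fun0.
case: insubP => [m' _ _|_]; last exact: homog_fun0.
exact: homog_funX.
Qed.

Definition exceptional :=
  exceptional_fun (coord_coef^~ 0%N) (coord_coef^~ 1%N) (coord_coef^~ 2%N).

Lemma exceptionalE w : exceptional (coords w 0) =
  let a := form_coef (val w) 0 in let b := form_coef (val w) 1 in
  let c := form_coef (val w) 2 in
  tang_res b c * (tang_discr b c)`_4 * \det (sylvester4 (sing_obstr b c) (tang_discr b c))
  * \det (gradient_mx a b c).
Proof. by rewrite /exceptional /exceptional_fun !coord_coefE. Qed.

Lemma coordsE w k : exists l i j n,
  [/\ (l < 3)%N, (i + j + n = 3)%N &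
     forall w', coords w' 0 k = form_coef (val w') l i j n].
Proof.
set m := val (val (enum_val k).2).
exists (enum_val k).1, (m 0%R), (m 1%R), (m 2%:R%R); split=> //.
  by rewrite -mdeg3; exact/eqP/(valP (enum_val k).2).
by move=> w'; rewrite mxE /form_coef valZpK /coef3 -mon3E.
Qed.

Let e0 : inZp 0 = 0 :> 'I_3. Proof. exact/val_inj. Qed.
Let e1 : inZp 1 = 1 :> 'I_3. Proof. exact/val_inj. Qed.
Let e2 : inZp 2 = 2%:R :> 'I_3. Proof. exact/val_inj. Qed.

Lemma omega1_coefE l i j k : (l < 3)%N -> form_coef (omega1 R) l i j k = omega1_coef C l i j k.
Proof.
have [E0 E1 E2] := omega1E R; rewrite /form_coef.
by case: l => [|[|[|//]]] _; rewrite ?e0 ?e1 ?e2 ?E0 ?E1 ?E2 /omega1_coef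
  -?coef3_mon /coef3 ?mcoeffB ?mcoeffN.
Qed.

Definition example_form : one_form R :=
  \row_j [:: M 1 2 0 - M 2 0 1; M 0 0 3 + M 0 1 2 - M 2 1 0;
             M 3 0 0 - M 0 1 2 - M 0 2 1]`_j.

Lemma example_coef : [/\ form_coef example_form 0 = ex_dx C,
  form_coef example_form 1 = ex_dy C & form_coef example_form 2 = ex_dz C].
Proof.
by split; apply/funext => i; apply/funext => j; apply/funext => k;
  rewrite /form_coef mxE /= /ex_dx /ex_dy /ex_dz -!coef3_mon /coef3 !(mcoeffB, mcoeffD).
Qed.

Lemma euler_example (K : comPzRingType) (x y z : K)
    (m := fun i j k => x ^+ i * y ^+ j * z ^+ k) :
  (m 1 2 0 - m 2 0 1) * x + (m 0 0 3 + m 0 1 2 - m 2 1 0) * y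
  + (m 3 0 0 - m 0 1 2 - m 0 2 1) * z = 0.
Proof. rewrite /m; ring. Qed.

Lemma example_cubic : is_cubic_form example_form.
Proof.
have hM a b c : (a + b + c = 3)%N -> M a b c \is ishomog1 3 mdeg.
  by move=> abc; rewrite dhomogX /= mdeg3 !mnm_tnth /= !(tnth_nth 0%N) /= abc.
apply/and3P; split.
- apply/eqP=> /rowP/(_ 1); rewrite !mxE /= => /(congr1 (fun p => coef3 p 0 0 3)).
  rewrite /coef3 mcoeffB mcoeffD mcoeff0 !mcoeffX !mon3_eq /= => /eqP.
  by rewrite !mulr0n addr0 subr0 oner_eq0.
- apply/forallP => j; rewrite mxE; case: j => -[|[|[|//]]] ? /=;
  by rewrite ?(rpredB, rpredD) ?hM.
rewrite sum3 !mxE /=.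
by rewrite -!Xvar3 euler_example.
Qed.

Definition example : form_space R :=
  exist (fun v => is_cubic_form v) _ example_cubic.

(** With a, b, c the coefficients of the example form and E = z^5 + y z^4 - y^5,
x E = x z^2 b - (y^3 + x y z) a and c = x^3 - y z (y + z).  Hence
y z (y + z) E = x^3 E - c E lies in the ideal (a, b, c); it does not involve x,
whereas the leading monomial of c is x^3. *)
Lemma ideal_example (K : comPzRingType) (m : nat -> nat -> nat -> K)
    (x y z d qa qb qc : K) (E := m 0 0 5 + m 0 1 4 - m 0 5 0) :
  (forall i j k, m i j k = x ^+ i * y ^+ j * z ^+ k) ->
  m 1 2 0 - m 2 0 1 = d * qa -> m 0 0 3 + m 0 1 2 - m 2 1 0 = d * qb ->
  m 3 0 0 - m 0 1 2 - m 0 2 1 = d * qc ->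
  m 0 1 1 * (m 0 1 0 + m 0 0 1) * E =
  d * (m 3 0 2 * qb - (m 2 3 0 + m 3 1 1) * qa - E * qc).
Proof.
move=> mE ea eb ec.
transitivity (m 3 0 2 * (d * qb) - (m 2 3 0 + m 3 1 1) * (d * qa) - E * (d * qc));
  last by ring.
by rewrite -ea -eb -ec /E !mE; ring.
Qed.

Lemma mlead_X0_free (p : mpoly 3 C) :
  (forall m : multinom 3, m 0%R != 0%N -> mcoeff m p = 0) -> mlead p 0%R = 0%N.
Proof.
move=> hp; have [->|p0] := eqVneq p 0; first by rewrite mlead0 mnm0E.
apply/eqP; apply: contraT => /hp /eqP.
by rewrite mleadc_eq0 (negPf p0).
Qed.

Lemma mcoeff_X0_free j k (m : multinom 3) : m 0%R != 0%N -> mcoeff m (M 0 j k) = 0.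
Proof.
move=> m0; rewrite mcoeffX; case: eqP => // e.
by rewrite -e mnm_tnth in m0.
Qed.

Lemma example_no_common_factor : no_common_factor example_form.
Proof.
move=> d hd.
have [qa] := hd 0; rewrite mxE /= => ea; have [qb] := hd 1; rewrite mxE /= => eb.
have [qc] := hd 2%:R; rewrite mxE /= => ec.
have eh := ideal_example (fun i j k => esym (Xvar3 R i j k)) ea eb ec.
have lead_f : mlead (M 3 0 0 - M 0 1 2 - M 0 2 1) = mon3 3 0 0.
  rewrite -addrA mleadDl mleadXm //.
  rewrite -opprD mleadN; apply: le_lt_trans (mleadD_le _ _) _.
  by rewrite !mleadXm ltUx !mon3_lt0.
have nz i j k (p : mpoly 3 C) : mcoeff (mon3 i j k) p = 1 -> p != 0.
  by move=> e; apply: contra_eq_neq e => ->; rewrite mcoeff0 eq_sym oner_eq0.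
have nz1 : M 0 1 1 != 0 by apply: (nz 0 1 1)%N; rewrite mcoeffX eqxx.
have nz2 : M 0 1 0 + M 0 0 1 != 0.
  by apply: (nz 0 1 0)%N; rewrite mcoeffD !mcoeffX !mon3_eq /= addr0.
have nz3 : M 0 0 5 + M 0 1 4 - M 0 5 0 != 0.
  by apply: (nz 0 0 5)%N; rewrite mcoeffB mcoeffD !mcoeffX !mon3_eq /= addr0 subr0.
apply: (coprime_mlead _ _ ec eh).
- by apply: (nz 3 0 0)%N; rewrite !mcoeffB !mcoeffX !mon3_eq /= !subr0.
- by rewrite !mulf_neq0.
move=> i; have [->|->|->] := ord3P i; [right|left|left]; last 2 first.
- by rewrite lead_f mnm_tnth.
- by rewrite lead_f mnm_tnth.
rewrite !mleadM ?mulf_neq0 // !mnmDE.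
rewrite !mlead_X0_free // => m m0; first by rewrite mcoeffB mcoeffD !mcoeff_X0_free // addr0 subr0.
  by rewrite mcoeffD !mcoeff_X0_free // addr0.
by rewrite mcoeff_X0_free.
Qed.

Lemma exceptional_example : exceptional (coords example 0) != 0.
Proof.
rewrite exceptionalE /=; have [-> -> ->] := example_coef.
rewrite !mulf_neq0 ?tang_res_example ?sylvester4_example ?gradient_mx_example //.
by rewrite tang_discr_example coefXn eqxx oner_eq0.
Qed.

(** The coefficients of omega1 on the line (t n0, t n1, 1 + t n2) through (0, 0, 1)
have no terms of degree 0 and 1 in t. *)
Lemma omega1_eval0 (K : comPzRingType) (t n0 n1 n2 : K) :
  (t * n0) ^+ 2 * (t * n1) ^+ 0 * (1 + t * n2) ^+ 1
  - (t * n0) ^+ 0 * (t * n1) ^+ 3 * (1 + t * n2) ^+ 0 =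
  t ^+ 2 * n0 ^+ 2 + t ^+ 3 * (n0 ^+ 2 * n2 - n1 ^+ 3).
Proof. ring. Qed.

Lemma omega1_eval1 (K : comPzRingType) (t n0 n1 n2 : K) :
  (t * n0) ^+ 1 * (t * n1) ^+ 2 * (1 + t * n2) ^+ 0 =
  t ^+ 2 * 0 + t ^+ 3 * (n0 * n1 ^+ 2).
Proof. ring. Qed.

Lemma omega1_eval2 (K : comPzRingType) (t n0 n1 n2 : K) :
  - ((t * n0) ^+ 3 * (t * n1) ^+ 0 * (1 + t * n2) ^+ 0) =
  t ^+ 2 * 0 + t ^+ 3 * - n0 ^+ 3.
Proof. ring. Qed.

(** If the pullback of w by A is proportional to omega1, the double zero (0, 0, 1) of
omega1 gives the double zero A (0, 0, 1) of w. *)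
Lemma gradient_mx_orbit w (A : 'M[C]_3) (c : C) : A \in unitmx ->
  (forall i, pullback A (val w) 0 i = c *: omega1 R 0 i) ->
  \det (gradient_mx (form_coef (val w) 0) (form_coef (val w) 1) (form_coef (val w) 2)) = 0.
Proof.
move=> uA eA; pose p : 'rV[C]_3 := \row_j A j 2%:R.
have p0 : p != 0.
  apply: contraTneq uA => /rowP p0; rewrite unitmxE unitfE -det_tr negbK.
  apply/det0P; exists (delta_mx 0 2%:R).
    by apply/eqP => /rowP/(_ 2%:R); rewrite !mxE eqxx /= => /eqP; rewrite oner_eq0.
  rewrite -rowE; apply/rowP => j; have := p0 j; rewrite !mxE.
  by [].
suff dp (l : nat) : double_point (form_coef (val w) l) p by exact: (gradient_mx_double_point p0).
move=> u; pose B := invmx A; pose n l := \sum_j B l j * u 0 j.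
pose al (i : nat) : C := nth 0 [:: n 0 ^+ 2; 0; 0] i.
pose be (i : nat) : C := nth 0 [:: n 0 ^+ 2 * n 2%:R - n 1 ^+ 3; n 0 * n 1 ^+ 2; - n 0 ^+ 3] i.
exists (\sum_i B i (inZp l) * (c * al i)), (\sum_i B i (inZp l) * (c * be i)) => t.
have /and3P[_ /forallP/(_ (inZp l)) hw _] := valP w.
pose x (j : 'I_3) := p 0 j + t * u 0 j.
rewrite -[LHS](meval_cubic x hw).
rewrite -[val w]pullback1 -(mulmxV uA) -pullback_comp meval_pullback.
have Bx j : \sum_k B j k * x k = (j == 2%:R)%:R + t * n j.
  transitivity ((B *m A) j 2%:R + t * n j); last by rewrite mulVmx // mxE.
  rewrite mxE mulr_sumr -big_split; apply: eq_bigr => k _.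
  by rewrite /x mxE mulrDr mulrCA.
have om_ev i : meval (fun j => \sum_k B j k * x k) (omega1 R 0 i) =
    t ^+ 2 * al i + t ^+ 3 * be i.
  rewrite (meval_eq _ Bx); have [E0 E1 E2] := omega1E R.
  have mM a b d : meval (fun j : 'I_3 => (j == 2%:R)%:R + t * n j) (M a b d) =
      (t * n 0) ^+ a * (t * n 1) ^+ b * (1 + t * n 2%:R) ^+ d.
    by rewrite -Xvar3 !rmorphM !rmorphXn /= !mevalXU /= !add0r.
  have [->|->|->] := ord3P i; rewrite ?E0 ?E1 ?E2 ?mevalB ?mevalN !mM /al /be /=.
  - exact: omega1_eval0.
  - exact: omega1_eval1.
  - exact: omega1_eval2.
rewrite !mulr_sumr -big_split; apply: eq_bigr => i _ /=.
rewrite eA mevalZ om_ev.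
by rewrite !mulrDr !(mulrCA _ (B i (inZp l))) !(mulrCA _ c).
Qed.

End ExceptionalPolynomial.

(** * Convergence to the model foliation *)

Section Limit.
Variable R : realType.
Local Notation C := (complex_field R).
Implicit Types (w : form_space R).

(** Its columns are p = (s, t, 1), e = (1, 0, 0) and (0, 1, 0); it sends (1, 0, 0)
to p and the line Z = 0 to the line through p and e. *)
Definition flag_mx (s t : C) : 'M[C]_3 :=
  \matrix_(i, j) nth 0 (nth [::] [:: [:: s; 1; 0]; [:: t; 0; 1]; [:: 1; 0; 0]] i) j.

Lemma flag_mx_unit s t : flag_mx s t \in unitmx.
Proof.
pose B : 'M[C]_3 := \matrix_(i, j)
  nth 0 (nth [::] [:: [:: 0; 0; 1]; [:: 1; 0; - s]; [:: 0; 1; - t]] i) j.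
suff /mulmx1_unit[] : flag_mx s t *m B = 1%:M by [].
apply/matrixP => i j; rewrite mxE sum3 !mxE /=.
have [->|->|->] := ord3P i; have [->|->|->] := ord3P j;
  rewrite /= ?(mulr0, mul0r, mulr1, mul1r, add0r, addr0, subrr, mulr0n, mulr1n) //.
Qed.

Lemma flag_mx_eval w s t i (x y z : C) :
  meval (fun j => nth 0 [:: x; y; z] j) (pullback (flag_mx s t) (val w) 0 i) =
  \sum_k flag_mx s t k i * cubic_eval (form_coef (val w) k) (s * x + y) (t * x + z) x.
Proof.
rewrite meval_pullback; apply: eq_bigr => k _; congr (_ * _).
have /and3P[_ /forallP/(_ k) hw _] := valP w.
rewrite (meval_cubic _ hw) !sum3 !mxE /=.
by rewrite !mul1r !mul0r !addr0 /form_coef valZpK.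
Qed.

(** The scalar is absorbed by the representative of the class of w. *)
Lemma pullback_orbit w (A : 'M[C]_3) (c : C) : A \in unitmx -> c != 0 ->
  exists w' : form_space R,
  [/\ PGL3_orbit (proj_class w) (proj_class w'),
      F22 R (proj_class w) -> F22 R (proj_class w') &
      forall i, val w' 0 i = c *: pullback A (val w) 0 i].
Proof.
move=> uA c0; have [w1 w1w e1] := scale_form w c0.
exists (exist (fun v => is_cubic_form v) _ (pullback_cubic uA (valP w1))); split.
- exists A; split=> //; exists w1.
  by exists (exist (fun v => is_cubic_form v) _ (pullback_cubic uA (valP w1))); split.
- move=> /F22P cw; apply/F22P; apply: pullback_no_common_factor => //.
  exact: no_common_factorZ c0 e1 cw.
exact: pullbackZ.
Qed.

Lemma euler_form w : euler_rel (form_coef (val w) 0) (form_coef (val w) 1) (form_coef (val w) 2).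
Proof. exact/euler_coef/(valP w). Qed.

Definition omega1_form : form_space R :=
  exist (fun v => is_cubic_form v) _ (omega1_cubic R).

Lemma cubic_eval_x (K : comPzRingType) (T : nat -> nat -> nat -> K) :
  cubic_eval T 1 0 0 = T 3 0 0.
Proof. by rewrite /cubic_eval; ring. Qed.

(** Substitute [flag_mx] to bring the flag to standard position, then apply
[degeneration_coef]; eps is chosen so that its product with the sum of
the finitely many constants is below e. *)
Lemma degenerate_omega1 w s t (beta : C) : beta != 0 ->
  (forall x y, cubic_eval (form_coef (val w) 0) (s * x + y) (t * x) x = beta * x * y ^+ 2) ->
  cubic_eval (form_coef (val w) 1) s t 1 != 0 ->
  forall e : C, 0 < e -> exists2 w' : form_space R,
    PGL3_orbit (proj_class w) (proj_class w') /\
    (F22 R (proj_class w) -> F22 R (proj_class w')) &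
    forall k, `|coords omega1_form 0 k - coords w' 0 k| < e.
Proof.
move=> b0 evb evc e e_gt0.
have uA := flag_mx_unit s t; set A := flag_mx s t in uA.
have hw0 := pullback_cubic uA (valP w); set w0 := pullback A (val w) in hw0.
pose T l := form_coef w0 l.
have evT l x y z : (l < 3)%N -> cubic_eval (T l) x y z =
    \sum_k A k (inZp l) * cubic_eval (form_coef (val w) k) (s * x + y) (t * x + z) x.
  move=> l3; rewrite -flag_mx_eval.
  have /and3P[_ /forallP/(_ (inZp l)) hl _] := hw0.
  by rewrite (meval_cubic _ hl).
have evb0 x y : cubic_eval (T 1%N) x y 0 = beta * x * y ^+ 2.
  by rewrite evT // sum3 !mxE /= mul1r !mul0r !addr0 evb.
have c0 : T 2%N 3 0 0 != 0.
  rewrite -cubic_eval_x evT // sum3 !mxE /= !mul0r add0r !addr0 mul1r.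
  by rewrite !mulr1.
pose kap := - beta / T 2%N 3 0 0.
have k0 : kap != 0 by rewrite mulf_neq0 ?oppr_eq0 ?invr_eq0.
pose d eps : 'rV[C]_3 := \row_j nth 0 [:: 1; eps; kap * eps ^+ 3] j.
(* The pullback by [flag_mx] followed by diag(1, eps, kap eps^3), divided by
   beta eps^3. *)
have approx eps : eps != 0 -> exists2 w' : form_space R,
    PGL3_orbit (proj_class w) (proj_class w') /\
    (F22 R (proj_class w) -> F22 R (proj_class w')) &
    forall l i j k, (l < 3)%N -> form_coef (val w') l i j k =
      (beta * eps ^+ 3)^-1 * (nth 0 [:: 1; eps; kap * eps ^+ 3] l *
      (1 ^+ i * eps ^+ j * (kap * eps ^+ 3) ^+ k) * T l i j k).
  move=> eps0.
  have uD : diag_mx (d eps) \in unitmx.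
    rewrite unitmxE det_diag prod3 !mxE /= mul1r unitfE.
    by rewrite mulf_neq0 // mulf_neq0 // expf_neq0.
  have uAD : A *m diag_mx (d eps) \in unitmx by rewrite unitmx_mul uA.
  have c'0 : (beta * eps ^+ 3)^-1 != 0 by rewrite invr_eq0 mulf_neq0 ?expf_neq0.
  have [w' [w'O w'F w'E]] := pullback_orbit w uAD c'0.
  exists w' => // l i j k l3.
  rewrite /form_coef /coef3 w'E -pullback_comp mcoeffZ mcoeff_pullback_diag prod3.
  have -> : mcoeff (mon3 i j k) (pullback A (val w) 0 (inZp l)) = T l i j k by [].
  by rewrite !mxE !mnm_tnth !(tnth_nth 0%N) /= modn_small.
have /choice[K hK] : forall k : 'I_#|form_index|, exists K : C, 0 <= K /\
    forall eps w', 0 < eps -> eps <= 1 ->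
    (forall l i j k, (l < 3)%N -> form_coef (val w') l i j k =
      (beta * eps ^+ 3)^-1 * (nth 0 [:: 1; eps; kap * eps ^+ 3] l *
      (1 ^+ i * eps ^+ j * (kap * eps ^+ 3) ^+ k) * T l i j k)) ->
    `|coords omega1_form 0 k - coords w' 0 k| <= eps * K.
  move=> k; have [l [i [j [n [l3 ijn kE]]]]] := coordsE w k.
  exists `|beta^-1 * kap ^+ (n + (l == 2)) * T l i j n|; split=> // eps w' eps0 eps1 w'E.
  rewrite !kE omega1_coefE // w'E //.
  exact: degeneration_coef (euler_coef hw0) evb0 b0 c0 erefl eps0 eps1 l3 ijn.
pose S := \sum_k K k.
have S0 : 0 <= S by apply: sumr_ge0 => k _; have [] := hK k.
have KS k : K k <= S.
  rewrite /S (bigD1 k) //= lerDl; apply: sumr_ge0 => j _; by have [] := hK j.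
have d0 : 0 < S + e + 1 by rewrite addr_gt0 // ltr_wpDl.
pose eps := e / (S + e + 1).
have eps0 : 0 < eps by rewrite divr_gt0.
have eps1 : eps <= 1.
  rewrite ler_pdivrMr // mul1r -addrA addrCA lerDl addr_ge0 //.
have [w' w'O w'E] := approx _ (lt0r_neq0 eps0).
exists w' => // k.
have [_ /(_ _ _ eps0 eps1 w'E) le_k] := hK k.
apply: le_lt_trans le_k _.
apply: le_lt_trans (ler_wpM2l (ltW eps0) (KS k)) _.
rewrite /eps mulrAC ltr_pdivrMr // ltr_pM2l // -addrA ltrDl.
by rewrite addr_gt0.
Qed.

End Limit.

(** * The exceptional set *)

Section Sigma.
Variable R : realType.
Local Notation C := (complex_field R).
Implicit Types (w : form_space R).

Lemma closure_orbit_F1 w : exceptional (coords w 0) != 0 -> F22 R (proj_class w) ->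
  closure_in_F22 (PGL3_orbit (proj_class w)) (F1 R).
Proof.
rewrite exceptionalE /= !mulf_eq0 !negb_or -!andbA => /and4P[r0 d4 dS _] Fw.
have [s [t [beta b0 [evb evc]]]] := inflection_point (euler_form w) r0 d4 dS.
apply: (@closure_in_F22P R _ (omega1_form R)).
  by apply/F22P; exact: omega1_no_common_factor.
move=> e e0; have [w' [w'O w'F] w'e] := degenerate_omega1 b0 evb evc e0.
by exists w' => //; split=> //; exact: w'F.
Qed.

(** A form whose orbit contains F1 has coefficients with a common double zero, so the
last factor vanishes. *)
Lemma F1_orbit_exceptional w : PGL3_orbit (proj_class w) (F1 R) -> exceptional (coords w 0) = 0.
Proof.
move=> [A [uA [w1 [w2 [/esym/proportionalP[c c0 e1] /esym/proportionalP[c' c'0 e2] e12]]]]].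
suff eA i : pullback A (val w) 0 i = (c^-1 * c') *: omega1 R 0 i.
  by rewrite exceptionalE /= (gradient_mx_orbit uA eA) mulr0.
have e : c *: pullback A (val w) 0 i = c' *: omega1 R 0 i.
  rewrite -(pullbackZ A e1) -e12; exact: e2.
by rewrite -scalerA -e scalerA mulVf // scale1r.
Qed.

Lemma F1_orbit_refl : PGL3_orbit (F1 R) (F1 R).
Proof.
exists 1%:M; split; first exact: unitmx1.
by exists (omega1_form R), (omega1_form R); split=> //; rewrite pullback1.
Qed.

Lemma exceptional_poly : exists2 p : mpoly #|form_index| C, p \is ishomog mdeg &
  forall w, meval (fun k => coords w 0 k) p = exceptional (coords w 0).
Proof.
have [d [p hp pE]] := homog_exceptional_fun (@homog_coord_coef R 0)
  (@homog_coord_coef R 1) (@homog_coord_coef R 2).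
by exists p; [exact: homogE hp | move=> w; rewrite pE].
Qed.

End Sigma.

Theorem mainTheorem3 (R : realType) :
  exists Sigma : set (P14 R),
    [/\ zariski_closed_in_F22 Sigma,
        Sigma !=set0,
        Sigma <> F22 R,
        forall F : P14 R, (F22 R `\` Sigma) F ->
          closure_in_F22 (PGL3_orbit F) (F1 R) &
        forall F : P14 R, (F22 R `\` Sigma) F ->
          ~ closed_in_F22 (PGL3_orbit F)].
Proof.
have [p hp pE] := exceptional_poly R.
pose I : set _ := [set p].
pose Sigma : set (P14 R) := F22 R `&` [set F | forall q, I q ->
  forall w : form_space R, proj_class w = F -> meval (fun k => coords w 0 k) q = 0].
have outside F : (F22 R `\` Sigma) F ->
    exists w, proj_class w = F /\ exceptional (coords w 0) != 0.
  move=> [FF nS]; apply: contrapT => h; apply: nS; split=> // q -> w wF.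
  rewrite pE; apply: contrapT => /eqP bw.
  by apply: h; exists w.
have closureP F : (F22 R `\` Sigma) F -> closure_in_F22 (PGL3_orbit F) (F1 R).
  move=> SF; have [w [wF bw]] := outside _ SF.
  by rewrite -wF; apply: closure_orbit_F1 => //; rewrite wF; case: SF.
exists Sigma; split=> //.
- by exists I; split=> // q ->.
- exists (F1 R); split; first by apply/(@F22P R (omega1_form R)); exact: omega1_no_common_factor.
  move=> q -> w wF; rewrite pE; apply: F1_orbit_exceptional.
  by rewrite wF; exact: F1_orbit_refl.
- move=> SF; have : Sigma (proj_class (example R)).
    by rewrite SF; apply/F22P; exact: example_no_common_factor.
  move=> [_ /(_ p erefl _ erefl)]; rewrite pE => /eqP.
  by rewrite (negPf (exceptional_example R)).
move=> F SF clF; have [w [wF /eqP bw]] := outside _ SF.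
apply: bw; apply: F1_orbit_exceptional; rewrite wF.
exact/clF/closureP.
Qed.
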